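(* Suppose a nonunital qubit map $\Phi$ which belongs to the interior of the cone of positivity-preserving maps and is defined by the matrix representation $$M(\Phi)=\begin{pmatrix}1&0&0&0\\ t_1&\lambda_1&0&0\\ t_2&0&\lambda_2&0\\ t_3&0&0&\lambda_3\end{pmatrix}.$$ Let $y$ be the largest real root of the quartic equation $y^4+by^3+cy^2+dy+e=0$ with coefficients $$b=t_1^2+t_2^2+t_3^2-\lambda_1^2-\lambda_2^2-\lambda_3^2-1,$$ $$c=\lambda_1^2(1-t_2^2-t_3^2)+\lambda_2^2(1-t_1^2-t_3^2)+\lambda_3^2(1-t_1^2-t_2^2)+\lambda_1^2\lambda_2^2+\lambda_2^2\lambda_3^2+\lambda_3^2\lambda_1^2,$$ $$d=t_1^2\lambda_2^2\lambda_3^2+\lambda_1^2t_2^2\lambda_3^2+\lambda_1^2\lambda_2^2t_3^2-\lambda_1^2\lambda_2^2\lambda_3^2-\lambda_1^2\lambda_2^2-\lambda_2^2\lambda_3^2-\lambda_3^2\lambda_1^2,$$ $$e=\lambda_1^2\lambda_2^2\lambda_3^2,$$ and let it define the coefficients $x_j=\dfrac{y\,t_j}{\lambda_j^2-y}$, $j=1,2,3$. Let $x=\sqrt{\sum_{j=1}^3x_j^2}$ and $\xi=\sqrt{\sum_{j=1}^3\lambda_j^2x_j^2}$. Then the operators $$\widetilde A=\frac{\sqrt{1+x}+\sqrt{1-x}}{2}\,I+\frac{\sqrt{1+x}-\sqrt{1-x}}{2x}\sum_{j=1}^3x_j\sigma_j,$$ $$\widetilde B=\frac{\sqrt{y+\xi}+\sqrt{y-\xi}}{2\sqrt{y^2-\xi^2}}\,I-\frac{\sqrt{y+\xi}-\sqrt{y-\xi}}{2\xi\sqrt{y^2-\xi^2}}\sum_{j=1}^3\lambda_jx_j\sigma_j$$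 are Hermitian and positive; the map $\Phi_{\widetilde A}\circ\Phi\circ\Phi_{\widetilde B}$ is unital, positive, trace preserving, and its matrix representation $M=M(\Phi_{\widetilde A}\circ\Phi\circ\Phi_{\widetilde B})$ reads $M_{00}=1$, $M_{0i}=M_{i0}=0$, $$M_{ij}=\frac{1-x^2}{\sqrt{y^2-\xi^2}}\left[\frac{\lambda_i\delta_{ij}}{\sqrt{1-x^2}}+\left(\frac{1-\sqrt{1-x^2}}{x^2\sqrt{y^2-\xi^2}}-\frac{(y-\sqrt{y^2-\xi^2})\lambda_i^2}{\xi^2\sqrt{1-x^2}\,y}\right)x_i\lambda_jx_j\right],$$ where $i,j=1,2,3$. The conventional decomposition $$[M_{ij}]_{i,j=1,2,3}=Q_{\widetilde U}\,\mathrm{diag}(\widetilde\lambda_1,\widetilde\lambda_2,\widetilde\lambda_3)\,Q_{\widetilde V}$$ with orthogonal matrices $Q_{\widetilde U}$ and $Q_{\widetilde V}$, $\det Q_{\widetilde U}=\det Q_{\widetilde V}=1$, leads to the unital map $\Upsilon=\Phi_{\widetilde U^\dagger\widetilde A}\circ\Phi\circ\Phi_{\widetilde B\widetilde V^\dagger}$ with diagonal matrix representation $M(\Upsilon)=\mathrm{diag}(1,\widetilde\lambda_1,\widetilde\lambda_2,\widetilde\lambda_3)$. Thus $\Upsilon=\Phi_A\circ\Phi\circ\Phi_B$ with operators $A=\widetilde U^{\dagger}\widetilde A$ and $B=\widetilde B\widetilde V^{\dagger}$.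
   Context: A qubit map is a linear map on $2\times2$ complex matrices. $\sigma_1,\sigma_2,\sigma_3$ are the Pauli matrices and $\sigma_0=I$ is the $2\times2$ identity. The matrix representation of a qubit map $\Phi$ is $M_{ij}(\Phi)=\tfrac12\mathrm{tr}\big[\sigma_i\Phi[\sigma_j]\big]$, $i,j=0,\dots,3$; the parameters $t_j,\lambda_j$ are real. For an operator $A$ on $\mathbb{C}^2$, $\Phi_A[X]=AXA^{\dagger}$. A map is unital if it sends $I$ to $I$, and positive (positivity preserving) if it sends positive-semidefinite operators to positive-semidefinite operators. For a unitary operator $U$ on $\mathbb{C}^2$, $Q_U$ denotes the $3\times3$ orthogonal matrix corresponding to $\Phi_U$, i.e. $M(\Phi_U)=\mathrm{diag}(1,Q_U)$ in block form; $\widetilde U$ and $\widetilde V$ are unitary operators corresponding to $Q_{\widetilde U}$ and $Q_{\widetilde V}$. $\delta_{ij}$ is the Kronecker delta. *)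

(* Defs.v *)
From HB Require Import structures.
From mathcomp Require Import all_boot all_order all_algebra.
From mathcomp Require Export complex.
From mathcomp Require Import all_classical all_reals all_analysis.

Set Implicit Arguments.
Unset Strict Implicit.
Unset Printing Implicit Defensive.

Import Order.TTheory GRing.Theory Num.Theory.
Import numFieldNormedType.Exports.
Local Open Scope classical_set_scope.
Local Open Scope ring_scope.
Local Open Scope complex_scope.
Local Open Scope sesquilinear_scope.

Section QubitMaps.
Variable R : realType.
Local Notation C := R[i].

Definition pauli (k : 'I_4) : 'M[C]_2 :=
  match val k with
  | 0%N => 1%:M
  | 1%N => \matrix_(a, b) (a != b)%:R
  | 2%N => \matrix_(a, b) (if a == b then 0 else if a == 0 then - 'i else 'i)
  | _ => \matrix_(a, b) (if a != b then 0 else if a == 0 then 1 else - 1)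
  end.

Definition psd (X : 'M[C]_2) : Prop :=
  X \is hermsymmx /\ forall v : 'cV[C]_2, 0 <= (v^t* *m X *m v) 0 0.

Definition pd (X : 'M[C]_2) : Prop :=
  X \is hermsymmx /\
  forall v : 'cV[C]_2, v != 0 -> 0 < (v^t* *m X *m v) 0 0.

(* The following notions make sense for any function on 2 x 2 matrices;
   linearity is carried by the type {linear 'M[C]_2 -> 'M[C]_2}. *)

Definition unital_map (Phi : 'M[C]_2 -> 'M[C]_2) : Prop := Phi 1%:M = 1%:M.

Definition trace_preserving (Phi : 'M[C]_2 -> 'M[C]_2) : Prop :=
  forall X, \tr (Phi X) = \tr X.

Definition positive_map (Phi : 'M[C]_2 -> 'M[C]_2) : Prop :=
  forall X, psd X -> psd (Phi X).

Definition conj_map (A X : 'M[C]_2) : 'M[C]_2 := A *m X *m A^t*.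

Definition map_matrix (Phi : 'M[C]_2 -> 'M[C]_2) : 'M[C]_4 :=
  \matrix_(i, j) (2^-1 * \tr (pauli i *m Phi (pauli j))).

(* Entrywise embedding of real matrices into complex ones. *)
Definition cmx m n (N : 'M[R]_(m, n)) : 'M[C]_(m, n) :=
  map_mx (fun a : R => a%:C) N.

(* Positive maps send Hermitian matrices to Hermitian matrices, so the cone
   they form lives in the real vector space of Hermiticity-preserving linear
   maps (among all complex-linear maps its interior would be empty).
   [map_matrix] identifies that space linearly with 'M[R]_4, and the interior
   is taken there. *)
Definition positive_cone : set 'M[R]_4 :=
  [set N | exists2 Psi : {linear 'M[C]_2 -> 'M[C]_2},
             positive_map Psi & map_matrix Psi = cmx N].

Definition interior_positive (Phi : 'M[C]_2 -> 'M[C]_2) : Prop :=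
  exists2 N : 'M[R]_4, map_matrix Phi = cmx N & interior positive_cone N.

Definition so3 (Q : 'M[R]_3) : Prop := Q *m Q^T = 1%:M /\ \det Q = 1.

(* diag(1, N) in block form. *)
Definition diag1 (N : 'M[R]_3) : 'M[R]_4 := block_mx (1%:M : 'M[R]_1) 0 0 N.

Definition unitary_of (U : 'M[C]_2) (Q : 'M[R]_3) : Prop :=
  U \is unitarymx /\ map_matrix (conj_map U) = cmx (diag1 Q).

Section NormalForm.
(* The triples (t_1, t_2, t_3) and (lambda_1, lambda_2, lambda_3), with
   indices shifted to 0, 1, 2. *)
Variables t l : 'rV[R]_3.
Local Notation t1 := (t 0 0).
Local Notation t2 := (t 0 1).
Local Notation t3 := (t 0 2).
Local Notation l1 := (l 0 0).
Local Notation l2 := (l 0 1).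
Local Notation l3 := (l 0 2).

Definition param_matrix : 'M[R]_4 :=
  block_mx (1%:M : 'M[R]_1) 0 t^T (diag_mx l).

Definition coef_b : R :=
  t1 ^+ 2 + t2 ^+ 2 + t3 ^+ 2 - l1 ^+ 2 - l2 ^+ 2 - l3 ^+ 2 - 1.

Definition coef_c : R :=
  l1 ^+ 2 * (1 - t2 ^+ 2 - t3 ^+ 2) + l2 ^+ 2 * (1 - t1 ^+ 2 - t3 ^+ 2)
  + l3 ^+ 2 * (1 - t1 ^+ 2 - t2 ^+ 2)
  + l1 ^+ 2 * l2 ^+ 2 + l2 ^+ 2 * l3 ^+ 2 + l3 ^+ 2 * l1 ^+ 2.

Definition coef_d : R :=
  t1 ^+ 2 * l2 ^+ 2 * l3 ^+ 2 + l1 ^+ 2 * t2 ^+ 2 * l3 ^+ 2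
  + l1 ^+ 2 * l2 ^+ 2 * t3 ^+ 2 - l1 ^+ 2 * l2 ^+ 2 * l3 ^+ 2
  - l1 ^+ 2 * l2 ^+ 2 - l2 ^+ 2 * l3 ^+ 2 - l3 ^+ 2 * l1 ^+ 2.

Definition coef_e : R := l1 ^+ 2 * l2 ^+ 2 * l3 ^+ 2.

Definition quartic_root (y : R) : Prop :=
  y ^+ 4 + coef_b * y ^+ 3 + coef_c * y ^+ 2 + coef_d * y + coef_e = 0.

Definition largest_root (y : R) : Prop :=
  quartic_root y /\ forall z, quartic_root z -> z <= y.

Variable y : R.

Definition xvec (j : 'I_3) : R := y * t 0 j / (l 0 j ^+ 2 - y).

Definition xnorm : R := Num.sqrt (\sum_j xvec j ^+ 2).

Definition xi : R := Num.sqrt (\sum_j l 0 j ^+ 2 * xvec j ^+ 2).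

Local Notation x := xnorm.

(* [lift ord0] sends j : 'I_3 to the index j + 1 of a nontrivial Pauli
   matrix. *)
Definition tildeA : 'M[C]_2 :=
  ((Num.sqrt (1 + x) + Num.sqrt (1 - x)) / 2)%:C *: 1%:M
  + ((Num.sqrt (1 + x) - Num.sqrt (1 - x)) / (2 * x))%:C
    *: \sum_(j < 3) (xvec j)%:C *: pauli (lift ord0 j).

(* xi vanishes exactly when all l_j * x_j do.  The 0/0 terms of [tildeB] and
   [reduced_matrix] are then 0, since 0^-1 = 0; this is also their limit as
   xi tends to 0. *)
Definition tildeB : 'M[C]_2 :=
  ((Num.sqrt (y + xi) + Num.sqrt (y - xi))
     / (2 * Num.sqrt (y ^+ 2 - xi ^+ 2)))%:C *: 1%:M
  - ((Num.sqrt (y + xi) - Num.sqrt (y - xi))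
     / (2 * xi * Num.sqrt (y ^+ 2 - xi ^+ 2)))%:C
    *: \sum_(j < 3) (l 0 j * xvec j)%:C *: pauli (lift ord0 j).

Definition reduced_matrix : 'M[R]_3 :=
  \matrix_(i, j)
    ((1 - x ^+ 2) / Num.sqrt (y ^+ 2 - xi ^+ 2)
     * (l 0 i * (i == j)%:R / Num.sqrt (1 - x ^+ 2)
        + ((1 - Num.sqrt (1 - x ^+ 2))
             / (x ^+ 2 * Num.sqrt (y ^+ 2 - xi ^+ 2))
           - (y - Num.sqrt (y ^+ 2 - xi ^+ 2)) * l 0 i ^+ 2
             / (xi ^+ 2 * Num.sqrt (1 - x ^+ 2) * y))
          * xvec i * l 0 j * xvec j)).

End NormalForm.

End QubitMaps.

(* Main.v *)
(* A qubit map acts affinely on Bloch coordinates, and conjugation by the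
   Hermitian operator a + w.sigma acts on [R^4] as a multiple of a Lorentz
   boost, so the normal form is a Lorentz singular value decomposition of [M].
   With [G = diag(1, -1, -1, -1)] the quartic is the characteristic polynomial
   of [G M^T G M].  Off its poles it equals [prod_j (s - l_j^2)] times the
   convex secular function [s - 1 + sum_j s t_j^2 / (s - l_j^2)].  Positivity of
   a slightly enlarged map yields, by an S-lemma type argument, a point above
   all poles where this function is negative.  By convexity the largest root [y]
   lies above that point and the slope at [y] is positive; the slope is
   [(y^2 - xi^2) / y^2 = (1 - x^2) / y], which gives [x < 1] and [xi < y].
   The eigenvector relations [y = 1 + t.x] and [l_j^2 x_j = y (x_j + t_j)] say
   that the adjoint of [Phi] maps [1 + x.sigma], the square of [tildeA], to
   [y + (l x).sigma], the inverse square of [tildeB], and that [Phi] maps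
   [y - (l x).sigma] to [y (1 - x.sigma)]. *)

Require Import Defs.
From HB Require Import structures.
From mathcomp Require Import all_boot all_order all_algebra.
From mathcomp Require Import complex.
From mathcomp Require Import all_classical all_reals all_analysis.
From mathcomp Require Import ring lra.

Set Implicit Arguments.
Unset Strict Implicit.
Unset Printing Implicit Defensive.

Import Order.TTheory GRing.Theory Num.Theory.
Import numFieldNormedType.Exports.
Local Open Scope ring_scope.
Local Open Scope complex_scope.
Local Open Scope sesquilinear_scope.

Lemma forall_ord3 (P : 'I_3 -> Prop) : P 0 -> P 1 -> P 2 -> forall j, P j.
Proof.
move=> P0 P1 P2 [[|[|[|//]]] j3].
- by rewrite (_ : Ordinal j3 = 0) //; apply: val_inj.
- by rewrite (_ : Ordinal j3 = 1) //; apply: val_inj.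
- by rewrite (_ : Ordinal j3 = 2) //; apply: val_inj.
Qed.

Lemma sum3 (V : nmodType) (F : 'I_3 -> V) : \sum_j F j = F 0 + F 1 + F 2.
Proof.
rewrite !big_ord_recl big_ord0 addr0 addrA.
by congr (_ + F _ + F _); apply: val_inj.
Qed.

(** * The secular equation *)

Section Secular.
Local Open Scope classical_set_scope.
Variable R : realType.
Implicit Types (t l : 'rV[R]_3) (s y z : R).

Definition secular t l s : R :=
  s - 1 + \sum_j s * t 0 j ^+ 2 / (s - l 0 j ^+ 2).

(** The derivative of [secular] in [s], since s / (s - a) has derivative -a / (s - a)^2. *)
Definition secular_slope t l s : R :=
  1 - \sum_j l 0 j ^+ 2 * t 0 j ^+ 2 / (s - l 0 j ^+ 2) ^+ 2.

(** Convexity above the poles, without differentiation: the gap between the function and its tangent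
    is an explicit sum of nonnegative fractions. *)
Lemma secular_tangent t l y z :
  (forall j, l 0 j ^+ 2 < y) -> (forall j, l 0 j ^+ 2 < z) ->
  secular t l y + secular_slope t l y * (z - y) <= secular t l z.
Proof.
move=> ly lz; rewrite -subr_ge0 /secular /secular_slope.
rewrite [leRHS](_ : _ = \sum_j
   l 0 j ^+ 2 * t 0 j ^+ 2 * (z - y) ^+ 2
     / ((z - l 0 j ^+ 2) * (y - l 0 j ^+ 2) ^+ 2)).
  apply: sumr_ge0 => j _; apply: divr_ge0;
    first by rewrite !(sqr_ge0, mulr_ge0).
  by rewrite mulr_ge0 ?sqr_ge0 // subr_ge0 ltW.
rewrite !sum3.
field.
by rewrite !subr_eq0 !gt_eqF.
Qed.

Lemma quartic_secular t l s : (forall j, l 0 j ^+ 2 < s) ->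
  s ^+ 4 + coef_b t l * s ^+ 3 + coef_c t l * s ^+ 2 + coef_d t l * s
    + coef_e l
  = (s - l 0 0 ^+ 2) * (s - l 0 1 ^+ 2) * (s - l 0 2 ^+ 2) * secular t l s.
Proof.
move=> ls; rewrite /secular sum3 /coef_b /coef_c /coef_d /coef_e.
field.
by rewrite !subr_eq0 !gt_eqF.
Qed.

Lemma quartic_root_secular t l s : (forall j, l 0 j ^+ 2 < s) ->
  quartic_root t l s <-> secular t l s = 0.
Proof.
move=> ls; rewrite /quartic_root quartic_secular //.
split=> [/eqP|->]; last by rewrite mulr0.
by rewrite mulf_eq0 => /orP[|/eqP//]; rewrite !mulf_eq0 !subr_eq0 !gt_eqF.
Qed.

Lemma secular_lt1 t l s : (forall j, l 0 j ^+ 2 < s) ->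
  secular t l s < 0 -> s < 1.
Proof.
move=> ls; rewrite /secular.
suff: 0 <= \sum_j s * t 0 j ^+ 2 / (s - l 0 j ^+ 2) by lra.
apply: sumr_ge0 => j _; apply: divr_ge0; last by rewrite subr_ge0 ltW.
apply: mulr_ge0; last exact: sqr_ge0.
by rewrite (le_trans (sqr_ge0 (l 0 0))) // ltW.
Qed.

(** The quartic changes sign between [s] and 1: all poles lie below [s < 1], and at 1 only the
    nonnegative fractions of [secular] remain. *)
Lemma quartic_root_above t l s : (forall j, l 0 j ^+ 2 < s) ->
  secular t l s < 0 -> exists2 y, s < y & quartic_root t l y.
Proof.
move=> ls gs; have s1 := secular_lt1 ls gs.
pose p : {poly R} := 'X^4 + coef_b t l *: 'X^3 + coef_c t l *: 'X^2
   + coef_d t l *: 'X + (coef_e l)%:P.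
have pE z : p.[z] = z ^+ 4 + coef_b t l * z ^+ 3 + coef_c t l * z ^+ 2
   + coef_d t l * z + coef_e l by rewrite /p !hornerE.
have ps : p.[s] < 0.
  by rewrite pE quartic_secular // pmulr_rlt0 // !mulr_gt0 // subr_gt0.
have p1 : 0 <= p.[1].
  have l1 j : l 0 j ^+ 2 < 1 by exact: lt_trans (ls j) s1.
  rewrite pE quartic_secular //; apply: mulr_ge0.
    by rewrite !mulr_ge0 // subr_ge0 ltW.
  rewrite /secular subrr add0r sumr_ge0 // => j _.
  by rewrite divr_ge0 ?mul1r ?sqr_ge0 // subr_ge0 ltW.
have [||y] := @poly_ivt _ p s 1; first exact: ltW.
  by rewrite (ltW ps) p1.
move=> /andP[sy _] /rootP; rewrite pE => py; exists y => //.
rewrite lt_neqAle sy andbT; apply: contraTneq ps => ->.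
by rewrite pE py ltxx.
Qed.

(** The tangent at the root [y] stays below the function, hence is negative at [s], which lies to
    the left of [y]. *)
Lemma secular_slope_gt0 t l s y : (forall j, l 0 j ^+ 2 < s) ->
  secular t l s < 0 -> s < y -> secular t l y = 0 -> 0 < secular_slope t l y.
Proof.
move=> ls gs sy gy; have ly j : l 0 j ^+ 2 < y by exact: lt_trans (ls j) sy.
have := secular_tangent t ly ls; rewrite gy add0r => /le_lt_trans.
by move=> /(_ _ gs); rewrite nmulr_llt0 // subr_lt0.
Qed.

Lemma largest_root_above t l s y : (forall j, l 0 j ^+ 2 < s) ->
  secular t l s < 0 -> largest_root t l y ->
  [/\ s < y, secular t l y = 0 & 0 < secular_slope t l y].
Proof.
move=> ls gs [ry ymax]; have [z sz /ymax zy] := quartic_root_above ls gs.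
have sy : s < y by exact: lt_le_trans zy.
have gy : secular t l y = 0.
  by apply/quartic_root_secular => // j; exact: lt_trans (ls j) sy.
by split=> //; exact: secular_slope_gt0 gy.
Qed.

(** Any root above [s] is already the largest: its tangent has positive slope, so [secular] is
    positive further right. *)
Lemma largest_root_exists t l s : (forall j, l 0 j ^+ 2 < s) ->
  secular t l s < 0 -> exists y, largest_root t l y.
Proof.
move=> ls gs; have [y sy ry] := quartic_root_above ls gs.
have ly j : l 0 j ^+ 2 < y by exact: lt_trans (ls j) sy.
have gy : secular t l y = 0 by apply/quartic_root_secular.
have slope_gt0 := secular_slope_gt0 ls gs sy gy.
exists y; split=> // z rz; rewrite leNgt; apply/negP => yz.
have lz j : l 0 j ^+ 2 < z by exact: lt_trans (ly j) yz.
have /quartic_root_secular-/(_ lz) gz := rz.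
have := secular_tangent t ly lz; rewrite gy gz add0r leNgt => /negP; apply.
by rewrite mulr_gt0 // subr_gt0.
Qed.

(* With [n_j = l_j t_j / (s - l_j^2)] one has
   [|t + l n|^2 = secular s + 1 - s * secular_slope s] and
   [|n|^2 = 1 - secular_slope s], so a point of slope zero is a unit vector
   where the image has squared norm [secular s + 1]. *)
Lemma secular_le0 t l : (forall j, t 0 j != 0) -> (forall j, l 0 j != 0) ->
  (forall n : 'rV[R]_3, \sum_j n 0 j ^+ 2 = 1 ->
     \sum_j (t 0 j + l 0 j * n 0 j) ^+ 2 <= 1) ->
  exists2 s, (forall j, l 0 j ^+ 2 < s) & secular t l s <= 0.
Proof.
move=> t0 l0 H.
suff [s ls hs] : exists2 s, (forall j, l 0 j ^+ 2 < s) & secular_slope t l s =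
  0.
  exists s => //.
  pose n : 'rV[R]_3 := \row_j (l 0 j * t 0 j / (s - l 0 j ^+ 2)).
  have sl j : s - l 0 j ^+ 2 != 0 by rewrite subr_eq0 gt_eqF.
  have n1 : \sum_j n 0 j ^+ 2 = 1.
    move: hs; rewrite /secular_slope => /eqP; rewrite subr_eq0 => /eqP ->.
    by apply: eq_bigr => j _; rewrite mxE exprMn exprVn exprMn.
  have := H _ n1.
  rewrite [leLHS](_ : _ = secular t l s - s * secular_slope t l s + 1).
    by rewrite hs mulr0 subr0 gerDr.
  rewrite /secular /secular_slope !sum3 !mxE.
  field.
  by rewrite !sl.
(* The slope vanishes where [h] equals 1; such a point is found by the intermediate value theorem to
   the right of the largest pole. *)
pose h s := \sum_j l 0 j ^+ 2 * t 0 j ^+ 2 / (s - l 0 j ^+ 2) ^+ 2.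
have [k kmax] : exists k, forall j, l 0 j ^+ 2 <= l 0 k ^+ 2.
  by case: (arg_maxP (fun j : 'I_3 => l 0 j ^+ 2) (erefl : xpredT 0)) => k _
    km; exists k => j; apply: km.
pose m := l 0 k ^+ 2.
have lt0 : 0 < `|l 0 k * t 0 k| by rewrite normr_gt0 mulf_neq0.
pose T := \sum_j l 0 j ^+ 2 * t 0 j ^+ 2.
have T0 : 0 <= T by apply: sumr_ge0 => j _; rewrite mulr_ge0 ?sqr_ge0.
(* At [s0] the term of index [k] alone equals 1. *)
pose s0 := m + `|l 0 k * t 0 k|.
(* At [s1] every denominator is at least (1 + T)^2, so [h s1] is at most T / (1 + T)^2. *)
pose s1 := s0 + 1 + T.
have hc : {within `[s0, s1]%classic, continuous h}.
  apply: continuous_in_subspaceT => s; rewrite inE /= in_itv /= => /andP[ss _].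
  have sl j : s - l 0 j ^+ 2 != 0.
    rewrite subr_eq0 gt_eqF // (le_lt_trans (kmax j)) //.
    by rewrite (lt_le_trans _ ss) // ltrDl.
  pose c j : R -> R := fun s => l 0 j ^+ 2 * t 0 j ^+ 2 / (s - l 0 j ^+ 2) ^+ 2.
  have cj j : {for s, continuous (c j)}.
    apply: cvgM; first exact: cvg_cst.
    apply: cvgV; first by rewrite expf_neq0.
    apply: (@continuous_comp _ _ _ (fun s : R => s - l 0 j ^+ 2) (fun z : R =>
      z ^+ 2)).
      by apply: cvgB; [exact: cvg_id|exact: cvg_cst].
    exact: exprn_continuous.
  have -> : h = c 0 + c 1 + c 2 by apply/funext => z; rewrite /h sum3.
  by apply: cvgD; [apply: cvgD|]; apply: cj.
have hs0 : 1 <= h s0.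
  rewrite /h (bigD1 k) //= /s0 addrAC subrr add0r real_normK ?num_real //.
  rewrite exprMn divff ?mulf_neq0 ?expf_neq0 //.
  by rewrite lerDl sumr_ge0 // => j _; rewrite !(divr_ge0, sqr_ge0, mulr_ge0).
have hs1 : h s1 <= 1.
  have TD : 0 < 1 + T by lra.
  apply: (@le_trans _ _ (T / (1 + T) ^+ 2)).
    rewrite /h /T mulr_suml; apply: ler_sum => j _.
    apply: ler_wpM2l; first by rewrite !(sqr_ge0, mulr_ge0).
    have lT : 1 + T <= s1 - l 0 j ^+ 2.
      by have := kmax j; rewrite /s1 /s0 -/m; move: lt0; lra.
    have d0 : 0 < s1 - l 0 j ^+ 2 by exact: lt_le_trans TD lT.
    by rewrite lef_pV2 ?posrE ?exprn_gt0 // ler_pXn2r ?nnegrE // ltW.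
  rewrite ler_pdivrMr ?exprn_gt0 //.
  by rewrite mul1r; nra.
have [||s] := @IVT R h s0 s1 1 _ hc; first by rewrite /s1; lra.
  by rewrite ge_min hs1 orbT le_max hs0.
rewrite in_itv /= => /andP[ss _] hs; exists s; last first.
  by rewrite /secular_slope -[X in 1 - X]/(h s) hs subrr.
by move=> j; rewrite (le_lt_trans (kmax j)) // (lt_le_trans _ ss) // ltrDl.
Qed.

(* A larger translation only makes [secular] grow, hence the hypothesis on a
   slightly enlarged map yields a strict inequality. *)
Lemma secular_lt0 t l t' l' :
  (forall j, t' 0 j != 0) -> (forall j, l' 0 j != 0) ->
  (forall j, t 0 j ^+ 2 < t' 0 j ^+ 2) ->
  (forall j, l 0 j ^+ 2 <= l' 0 j ^+ 2) ->
  (forall n : 'rV[R]_3, \sum_j n 0 j ^+ 2 = 1 ->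
     \sum_j (t' 0 j + l' 0 j * n 0 j) ^+ 2 <= 1) ->
  exists2 s, (forall j, l 0 j ^+ 2 < s) & secular t l s < 0.
Proof.
move=> t0 l0 tt ll /(secular_le0 t0 l0)[s ls gs]; exists s => [j|].
  exact: le_lt_trans (ll j) (ls j).
apply: lt_le_trans gs; rewrite /secular ltrD2l.
have s0 : 0 < s by exact: le_lt_trans (sqr_ge0 _) (ls 0).
have term j : s * t 0 j ^+ 2 / (s - l 0 j ^+ 2)
    < s * t' 0 j ^+ 2 / (s - l' 0 j ^+ 2).
  have d' : 0 < s - l' 0 j ^+ 2 by rewrite subr_gt0.
  have d : 0 < s - l 0 j ^+ 2 by have := ll j; lra.
  rewrite -!(mulrA s) ltr_pM2l // ltr_pdivrMr // mulrAC ltr_pdivlMr //.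
  have := tt j; have := sqr_ge0 (t 0 j); have := ll j; move: d' d.
  set a := l' 0 j ^+ 2; set b := l 0 j ^+ 2; set u := t 0 j ^+ 2.
  by set v := t' 0 j ^+ 2; nra.
by rewrite !sum3 !ltrD.
Qed.

End Secular.

(** * Singular value decomposition of real matrices *)

(** Over the closed field [R[i]] an eigenvector v exists. The scalar v A v* equals its own conjugate
    and is the eigenvalue times |v|^2, so the eigenvalue is real. *)
Lemma symmetric_eigenvalue (R : rcfType) n (A : 'M[R]_n.+1) :
  A^T = A -> exists a, eigenvalue A a.
Proof.
move=> AT; pose f : {rmorphism R -> R[i]} := real_complex R.
have [a] := eigenvalue_closed (map_mx f A) (ltn0Sn n).
move=> /[dup] ea /eigenvalueP[v vA v0].
have AC : (map_mx f A) ^t* = map_mx f A.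
  rewrite map_trmx AT -map_mx_comp; apply: eq_map_mx => x.
  exact: conjc_real.
have vv : 0 < (v *m v ^t*) 0 0 by rewrite -dotmxE dnorm_gt0.
have : (v *m map_mx f A *m v ^t*) ^t* = v *m map_mx f A *m v ^t*.
  by rewrite !trmx_mul !map_mxM trmxCK AC mulmxA.
rewrite vA -scalemxAl linearZ map_mxZ /= trmx_mul map_mxM trmxCK.
move=> /matrixP/(_ 0 0); rewrite [LHS]mxE [RHS]mxE => /(mulIf (lt0r_neq0 vv)).
move=> /eqP; rewrite -CrealE => /complex_realP[k ak].
by exists k; rewrite -(eigenvalue_map f) -[f k]/(k%:C)%C -ak.
Qed.

Section OrthogonalMatrices.
Variable R : rcfType.

Definition sqnorm n (u : 'rV[R]_n) : R := (u *m u^T) 0 0.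

Lemma sqnormE n (u : 'rV[R]_n) : sqnorm u = \sum_j u 0 j ^+ 2.
Proof. by rewrite /sqnorm mxE; apply: eq_bigr => j _; rewrite mxE expr2. Qed.

Lemma mulmx_tr_sqnorm n (u : 'rV[R]_n) : u *m u^T = (sqnorm u)%:M.
Proof. exact: mx11_scalar. Qed.

Lemma sqnorm_ge0 n (u : 'rV[R]_n) : 0 <= sqnorm u.
Proof. by rewrite sqnormE sumr_ge0 // => j _; rewrite sqr_ge0. Qed.

Lemma sqnorm_eq0 n (u : 'rV[R]_n) : (sqnorm u == 0) = (u == 0).
Proof.
apply/idP/eqP => [|->]; last by rewrite /sqnorm mul0mx mxE.
rewrite sqnormE psumr_eq0 => [/allP u0|j _]; last exact: sqr_ge0.
apply/rowP => j; apply/eqP; rewrite mxE -sqrf_eq0.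
by apply: u0; rewrite mem_index_enum.
Qed.

Lemma sqnormZ n a (u : 'rV[R]_n) : sqnorm (a *: u) = a ^+ 2 * sqnorm u.
Proof. by rewrite /sqnorm linearZ /= -scalemxAl -scalemxAr scalerA mxE expr2.
  Qed.

Lemma unit_rescale n (u : 'rV[R]_n) : u != 0 ->
  exists2 a, a != 0 & sqnorm (a *: u) = 1.
Proof.
rewrite -sqnorm_eq0 => u0; have u_gt0 : 0 < sqnorm u.
  by rewrite lt_neqAle eq_sym u0 sqnorm_ge0.
exists (Num.sqrt (sqnorm u))^-1; first by rewrite invr_eq0 sqrtr_eq0 -ltNge.
by rewrite sqnormZ exprVn sqr_sqrtr ?sqnorm_ge0 // mulVf.
Qed.

Definition orthogonalmx n (Q : 'M[R]_n) : Prop := Q *m Q^T = 1%:M.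

Lemma orthogonalmxM n (P Q : 'M[R]_n) :
  orthogonalmx P -> orthogonalmx Q -> orthogonalmx (P *m Q).
Proof.
by move=> PP QQ; rewrite /orthogonalmx trmx_mul mulmxA -(mulmxA P) QQ mulmx1.
Qed.

(** The reflection in the hyperplane orthogonal to [w], acting on row vectors from the right. *)
Definition householder n (w : 'rV[R]_n) : 'M[R]_n :=
  1%:M - (2 / sqnorm w) *: (w^T *m w).

Lemma trmx_householder n (w : 'rV[R]_n) : (householder w)^T = householder w.
Proof. by rewrite /householder linearB linearZ /= trmx1 trmx_mul trmxK. Qed.

(* Also for [w = 0], where [householder w] is the identity. *)
Lemma householder_orthogonal n (w : 'rV[R]_n) : orthogonalmx (householder w).
Proof.
rewrite /orthogonalmx trmx_householder /householder.
have [->|w0] := eqVneq w 0; first by rewrite mulmx0 scaler0 subr0 mulmx1.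
set P := w^T *m w; have PP : P *m P = sqnorm w *: P.
  by rewrite /P mulmxA -(mulmxA w^T) mulmx_tr_sqnorm mul_mx_scalar -scalemxAl.
rewrite mulmxBl mul1mx mulmxBr mulmx1 -scalemxAl -scalemxAr PP !scalerA.
have -> : 2 / sqnorm w * (2 / sqnorm w) * sqnorm w = 2 / sqnorm w + 2 / sqnorm
  w.
  by field; rewrite sqnorm_eq0.
by rewrite scalerDl opprB addrK subrK.
Qed.

(** For equal norms |u - v|^2 = 2 u.(u - v), so the reflection subtracts exactly u - v from u. *)
Lemma householder_reflect n (u v : 'rV[R]_n) : sqnorm u = sqnorm v ->
  u *m householder (u - v) = v.
Proof.
move=> uv; have [/eqP|w0] := eqVneq (u - v) 0.
  rewrite subr_eq0 => /eqP ->.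
  by rewrite /householder subrr mulmx0 scaler0 subr0 mulmx1.
have entryB (A B : 'M[R]_1) : (A - B) 0 0 = A 0 0 - B 0 0 by rewrite !mxE.
have vu : (v *m u^T) 0 0 = (u *m v^T) 0 0.
  by rewrite -[v *m u^T]trmxK trmx_mul trmxK mxE.
have nw : sqnorm (u - v) = 2 * (sqnorm u - (u *m v^T) 0 0).
  transitivity (sqnorm u + sqnorm v - (v *m u^T) 0 0 - (u *m v^T) 0 0).
    rewrite /sqnorm linearB /= mulmxBl !mulmxBr !entryB.
    ring.
  by rewrite vu uv; ring.
rewrite /householder mulmxBr mulmx1 -scalemxAr mulmxA.
rewrite [u *m _]mx11_scalar mul_scalar_mx scalerA.
have uw : (u *m (u - v)^T) 0 0 = sqnorm u - (u *m v^T) 0 0.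
  by rewrite linearB /= mulmxBr entryB.
rewrite (_ : _ * _ = 1) ?scale1r ?subKr // uw.
have /negPf := w0; rewrite -sqnorm_eq0 nw mulf_eq0 pnatr_eq0 /= => nz.
by field; rewrite nz.
Qed.

Lemma unit_delta n (i : 'I_n) : sqnorm (delta_mx 0 i : 'rV[R]_n) = 1.
Proof. by rewrite /sqnorm trmx_delta mul_delta_mx mxE !eqxx. Qed.

(* For [a > 0] the right singular vector is the normalised image of the left
   one; for [a = 0] both come from the kernels of [M] and [M^T]. *)
Lemma singular_vectors n (M : 'M[R]_n.+1) : exists (u v : 'rV[R]_n.+1) s,
  [/\ sqnorm u = 1, sqnorm v = 1, u *m M = s *: v & v *m M^T = s *: u].
Proof.
have [|a /eigenvalueP[u0]] := @symmetric_eigenvalue R n (M *m M^T).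
  by rewrite trmx_mul trmxK.
move=> e0 /unit_rescale[b b0 u1]; set u := b *: u0 in u1.
have e : u *m (M *m M^T) = a *: u by rewrite -scalemxAl e0 !scalerA mulrC.
have na : sqnorm (u *m M) = a.
  rewrite /sqnorm trmx_mul mulmxA -(mulmxA u) e -scalemxAl mxE.
  by rewrite -/(sqnorm u) u1 mulr1.
have [a0|a_neq0] := eqVneq a 0.
  have uM : u *m M = 0 by apply/eqP; rewrite -sqnorm_eq0 na a0.
  have : \det M^T == 0.
    rewrite det_tr; apply/det0P; exists u => //.
    by rewrite -sqnorm_eq0 u1 oner_eq0.
  move=> /det0P[v0 /unit_rescale[c _ v1] vM].
  by exists u, (c *: v0), 0; split;
    rewrite // ?uM ?scale0r // -scalemxAl vM scaler0.
have a_gt0 : 0 < a by rewrite lt_neqAle eq_sym a_neq0 -na sqnorm_ge0.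
have s0 : Num.sqrt a != 0 by rewrite sqrtr_eq0 -ltNge.
have ss : Num.sqrt a ^+ 2 = a by rewrite sqr_sqrtr // ltW.
exists u, ((Num.sqrt a)^-1 *: (u *m M)), (Num.sqrt a); split=> //.
- by rewrite sqnormZ na exprVn ss mulVf.
- by rewrite scalerA divff // scale1r.
- by rewrite -scalemxAl -mulmxA e scalerA -{2}ss expr2 mulrA mulVf // mul1r.
Qed.

(** Deflation by induction on the size: reflections move a pair of singular vectors to the first
    basis vector, which splits off a 1 by 1 block. *)
Lemma singular_value_decomposition n (M : 'M[R]_n) :
  exists (P Q : 'M[R]_n) (d : 'rV[R]_n),
    [/\ orthogonalmx P, orthogonalmx Q & M = P *m diag_mx d *m Q].
Proof.
elim: n M => [|n IHn] M.
  by exists 0, 0, 0; split; apply/matrixP => -[].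
have [u [v [s [u1 v1 uM vM]]]] := singular_vectors M.
pose e : 'rV[R]_n.+1 := delta_mx 0 0.
pose H := householder (e - u); pose K := householder (e - v).
have eH : e *m H = u by rewrite householder_reflect // unit_delta.
have eK : e *m K = v by rewrite householder_reflect // unit_delta.
have [HH KK] : orthogonalmx H /\ orthogonalmx K.
  by split; exact: householder_orthogonal.
have [HT KT] : H^T = H /\ K^T = K by split; exact: trmx_householder.
rewrite /orthogonalmx HT in HH; rewrite /orthogonalmx KT in KK.
pose N : 'M[R]_(1 + n) := H *m M *m K.
(* The reflections exchange [e] with [u] and with [v], so the first row and the first column of [N]
   are both [s] times [e]. *)
have eN : e *m N = s *: e.
  by rewrite !mulmxA eH uM -scalemxAl -eK -mulmxA KK mulmx1.
have eNT : e *m N^T = s *: e.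
  by rewrite !trmx_mul KT HT !mulmxA eK vM -scalemxAl -eH -mulmxA HH mulmx1.
have [P [Q [d [PP QQ dN]]]] := IHn (drsubmx N).
have N0j j : N 0 j = s * (j == 0)%:R.
  by have /rowP/(_ j) := eN; rewrite -rowE !mxE eqxx.
have Ni0 i : N i 0 = s * (i == 0)%:R.
  by have /rowP/(_ i) := eNT; rewrite -rowE !mxE eqxx.
have l0 i : lshift n (i : 'I_1) = 0 by rewrite ord1; apply: val_inj.
have NE : N = block_mx s%:M 0 0 (drsubmx N).
  rewrite -{1}[N]submxK; congr block_mx; apply/matrixP => i j.
  - by rewrite !ord1 [RHS]mxE [LHS]mxE [LHS]mxE l0 N0j eqxx mulr1.
  - by rewrite [RHS]mxE [LHS]mxE [LHS]mxE l0 N0j mulr0.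
  - by rewrite [RHS]mxE [LHS]mxE [LHS]mxE l0 Ni0 mulr0.
pose B (X : 'M[R]_n) : 'M[R]_(1 + n) := block_mx 1%:M 0 0 X.
have BB X : orthogonalmx X -> orthogonalmx (B X).
  rewrite /orthogonalmx /B => XX; rewrite tr_block_mx mulmx_block !trmx0 trmx1.
  by rewrite !(mulmx0, mul0mx, addr0, add0r) mulmx1 XX -scalar_mx_block.
exists (H *m B P), (B Q *m K), (row_mx s%:M d); split.
- by apply: orthogonalmxM (BB _ PP); exact: householder_orthogonal.
- by apply: orthogonalmxM (BB _ QQ) _; exact: householder_orthogonal.
have -> : M = H *m N *m K.
  by rewrite !mulmxA HH mul1mx -mulmxA KK mulmx1.
have dE : @diag_mx _ (1 + n) (row_mx s%:M d) = block_mx s%:M 0 0 (diag_mx d).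
  rewrite diag_mx_row; congr block_mx.
  by apply/matrixP => i j; rewrite !ord1 !mxE.
rewrite NE [diag_mx _]dE dN.
rewrite (_ : block_mx s%:M 0 0 _ = B P *m block_mx s%:M 0 0 (diag_mx d) *m B Q).
  by rewrite !mulmxA.
by rewrite !mulmx_block !(mulmx0, mul0mx, addr0, add0r) mul1mx mulmx1.
Qed.

Lemma det_orthogonalmx n (Q : 'M[R]_n) : orthogonalmx Q -> \det Q * \det Q = 1.
Proof. by move=> QQ; rewrite -{2}det_tr -det_mulmx QQ det1. Qed.

End OrthogonalMatrices.

(** * Pauli coordinates *)

Lemma forall_ord2 (P : 'I_2 -> Prop) : P 0 -> P 1 -> forall j, P j.
Proof.
move=> P0 P1 [[|[|//]] j2].
- by rewrite (_ : Ordinal j2 = 0) //; apply: val_inj.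
- by rewrite (_ : Ordinal j2 = 1) //; apply: val_inj.
Qed.

Lemma sum2 (V : nmodType) (F : 'I_2 -> V) : \sum_j F j = F 0 + F 1.
Proof.
rewrite !big_ord_recl big_ord0 addr0.
by congr (_ + F _); apply: val_inj.
Qed.

Lemma matrix2P (T : Type) (A B : 'M[T]_2) :
  A 0 0 = B 0 0 -> A 0 1 = B 0 1 -> A 1 0 = B 1 0 -> A 1 1 = B 1 1 -> A = B.
Proof.
by move=> *; apply/matrixP; apply: forall_ord2; apply: forall_ord2.
Qed.

Lemma mulmx2E (S : pzSemiRingType) m n (A : 'M[S]_(m, 2)) (B : 'M[S]_(2, n)) i
  j :
  (A *m B) i j = A i 0 * B 0 j + A i 1 * B 1 j.
Proof. by rewrite mxE sum2. Qed.

Lemma forall_ordS n (P : 'I_n.+1 -> Prop) :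
  P 0 -> (forall j, P (lift ord0 j)) -> forall i, P i.
Proof. by move=> P0 PS i; case: (unliftP ord0 i) => [j|] ->. Qed.

Section Pauli.
Variable R : realType.
Local Notation C := R[i].

(** A Hermitian matrix as the point (p, v) of Minkowski space: its eigenvalues are p + |v| and p -
    |v|, its determinant is p^2 - |v|^2. *)
Definition hermitian2 (p : R) (v : 'rV[R]_3) : 'M[C]_2 :=
  p%:C *: 1%:M + \sum_j (v 0 j)%:C *: pauli R (lift ord0 j).

Lemma complexP (z w : C) :
  complex.Re z = complex.Re w -> complex.Im z = complex.Im w -> z = w.
Proof. by case: z w => [a b] [c d] /= -> ->. Qed.

Lemma hermitian2_entries p v :
  [/\ hermitian2 p v 0 0 = (p + v 0 2)%:C,
      hermitian2 p v 0 1 = v 0 0 -i* v 0 1,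
      hermitian2 p v 1 0 = v 0 0 +i* v 0 1 &
      hermitian2 p v 1 1 = (p - v 0 2)%:C].
Proof.
rewrite /hermitian2 sum3 /pauli /=.
by split; rewrite !mxE /=; apply: complexP => /=; ring.
Qed.

Lemma conjE (a b : R) : Num.conj (a +i* b : C) = a -i* b.
Proof. by []. Qed.

Lemma hermitian2_adj p v : (hermitian2 p v)^t* = hermitian2 p v.
Proof.
have [e00 e01 e10 e11] := hermitian2_entries p v.
apply: matrix2P; rewrite [LHS]mxE [in LHS]mxE ?e00 ?e01 ?e10 ?e11.
- exact: conjc_real.
- by [].
- by rewrite conjE opprK.
- exact: conjc_real.
Qed.

Lemma pauli0 : pauli R 0 = hermitian2 1 0.
Proof.
rewrite /hermitian2 big1 ?addr0 ?scale1r // => j _.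
by rewrite mxE scale0r.
Qed.

Lemma pauliS j : pauli R (lift ord0 j) = hermitian2 0 (delta_mx 0 j).
Proof.
rewrite /hermitian2 scale0r add0r (bigD1 j) //= mxE !eqxx scale1r.
rewrite big1 ?addr0 // => k /negPf kj; by rewrite mxE kj andbF scale0r.
Qed.

Lemma pauli_coord0 p v : 2^-1 * \tr (pauli R 0 *m hermitian2 p v) = p%:C.
Proof.
have [e00 e01 e10 e11] := hermitian2_entries p v.
apply: (mulfI (_ : 2%:R != 0 :> C)); first by rewrite pnatr_eq0.
rewrite mulVKf ?pnatr_eq0 // mul1mx /mxtrace sum2 e00 e11.
by apply: complexP => /=; ring.
Qed.

Lemma pauli_coordS p v j :
  2^-1 * \tr (pauli R (lift ord0 j) *m hermitian2 p v) = (v 0 j)%:C.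
Proof.
have [e00 e01 e10 e11] := hermitian2_entries p v.
apply: (mulfI (_ : 2%:R != 0 :> C)); first by rewrite pnatr_eq0.
rewrite mulVKf ?pnatr_eq0 // /mxtrace sum2 !mxE !sum2.
rewrite e00 e01 e10 e11 /pauli; move: j.
by apply: forall_ord3; rewrite /= !mxE /=; apply: complexP => /=; ring.
Qed.

(** The Pauli matrices are an orthogonal basis for the trace form, each of square norm 2. *)
Lemma pauli_expansion (X : 'M[C]_2) :
  X = \sum_k (2^-1 * \tr (pauli R k *m X)) *: pauli R k.
Proof.
rewrite big_ord_recl sum3 /mxtrace !sum2 !mxE !sum2 /pauli.
have h : 2^-1 = (2^-1)%:C :> C by rewrite fmorphV rmorph_nat.
rewrite h.
apply: matrix2P; rewrite !mxE /=.
all: case: (X 0 0) (X 0 1) (X 1 0) (X 1 1) => [a b] [c d] [e f] [g k].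
all: by apply: complexP => /=; field.
Qed.

Lemma map_matrixM (F : {linear 'M[C]_2 -> 'M[C]_2}) (G : 'M[C]_2 -> 'M[C]_2) :
  map_matrix (F \o G) = map_matrix F *m map_matrix G.
Proof.
apply/matrixP => i j; rewrite !mxE /= {1}[G _]pauli_expansion linear_sum.
rewrite mulmx_sumr linear_sum mulr_sumr; apply: eq_bigr => k _ /=.
by rewrite !mxE linearZ -scalemxAr linearZ /= mulrCA mulrC mulrA.
Qed.

(** Membership of a matrix in [positive_cone] only provides some positive map with that matrix;
    injectivity identifies it with the given one. *)
Lemma map_matrix_inj (F G : {linear 'M[C]_2 -> 'M[C]_2}) :
  map_matrix F = map_matrix G -> F =1 G.
Proof.
move=> FG X; rewrite [X]pauli_expansion !linear_sum; apply: eq_bigr => k _.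
rewrite !linearZ /=; congr (_ *: _).
rewrite [LHS]pauli_expansion [RHS]pauli_expansion; apply: eq_bigr => i _.
by congr (_ *: _); move/matrixP: FG => /(_ i k); rewrite !mxE.
Qed.

Lemma conj_map_is_linear (A : 'M[C]_2) : linear (conj_map A).
Proof.
by move=> a X Y; rewrite /conj_map mulmxDr mulmxDl -scalemxAr -scalemxAl.
Qed.

(** Makes composites with [conj_map] linear maps, as multiplicativity of [map_matrix] requires. *)
HB.instance Definition _ (A : 'M[C]_2) :=
  GRing.isLinear.Build C 'M[C]_2 'M[C]_2 _ (conj_map A) (conj_map_is_linear A).

End Pauli.

(** * Action of qubit maps on Pauli coordinates *)

Section Action.
Variable R : realType.
Local Notation C := R[i].
Implicit Types (v w : 'rV[R]_3) (p a : R).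

Definition dotr v w : R := \sum_j v 0 j * w 0 j.

Lemma pauli_coord_inj (X Y : 'M[C]_2) :
  (forall k, 2^-1 * \tr (pauli R k *m X) = 2^-1 * \tr (pauli R k *m Y)) ->
    X = Y.
Proof.
move=> XY; rewrite [X]pauli_expansion [Y]pauli_expansion.
by apply: eq_bigr => k _; rewrite XY.
Qed.

Lemma block_entries a (r c : 'rV[R]_3) (N : 'M[R]_3) :
  let M : 'M[R]_(1 + 3) := block_mx a%:M r c^T N in
  [/\ M 0 0 = a,
      forall j, M 0 (lift ord0 j) = r 0 j,
      forall i, M (lift ord0 i) 0 = c 0 i &
      forall i j, M (lift ord0 i) (lift ord0 j) = N i j].
Proof.
have z : (0 : 'I_4) = lshift 3 (0 : 'I_1) by apply: val_inj.
split=> [|j|i|i j]; rewrite ?z -?rshift1.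
- by rewrite block_mxEul mxE.
- by rewrite block_mxEur.
- by rewrite block_mxEdl mxE.
- by rewrite block_mxEdr.
Qed.

Lemma cmx_block_entries a (r c : 'rV[R]_3) (N : 'M[R]_3) :
  let M : 'M[C]_4 := cmx (block_mx a%:M r c^T N : 'M[R]_(1 + 3)) in
  [/\ M 0 0 = a%:C,
      forall j, M 0 (lift ord0 j) = (r 0 j)%:C,
      forall i, M (lift ord0 i) 0 = (c 0 i)%:C &
      forall i j, M (lift ord0 i) (lift ord0 j) = (N i j)%:C].
Proof.
have [e00 e0S eS0 eSS] := block_entries a r c N.
by split=> *; rewrite mxE ?e00 ?e0S ?eS0 ?eSS.
Qed.

Lemma map_matrix_action (F : {linear 'M[C]_2 -> 'M[C]_2}) a r c N :
  map_matrix F = cmx (block_mx a%:M r c^T N : 'M[R]_(1 + 3)) ->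
  forall p v, F (hermitian2 p v) = hermitian2 (a * p + dotr r v) (p *: c + v *m
    N^T).
Proof.
move=> FM p v; have [M00 M0j Mi0 Mij] := cmx_block_entries a r c N.
have coefF i j : 2^-1 * \tr (pauli R i *m F (pauli R j)) = map_matrix F i j.
  by rewrite mxE.
apply: pauli_coord_inj => k.
rewrite {1}/hermitian2 linearD linearZ linear_sum /= mulmxDr mulmx_sumr.
rewrite mxtraceD raddf_sum mulrDr -scalemxAr mxtraceZ mulrCA.
rewrite -[1%:M]/(pauli R 0) coefF FM mulr_sumr.
under eq_bigr do rewrite linearZ /= -scalemxAr mxtraceZ mulrCA coefF FM.
move: k; apply: forall_ordS => [|i].
  rewrite pauli_coord0 M00 rmorphD rmorphM /= mulrC rmorph_sum; congr (_ + _).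
  by apply: eq_bigr => j _; rewrite M0j -rmorphM mulrC.
rewrite pauli_coordS Mi0 !mxE rmorphD rmorphM /= rmorph_sum; congr (_ + _).
by apply: eq_bigr => j _; rewrite Mij -rmorphM mxE.
Qed.

(** Converse of [map_matrix_action]: the Pauli matrices have the standard basis of Minkowski space
    as coordinates, so evaluating there reads off the entries. *)
Lemma map_matrixE (F : 'M[C]_2 -> 'M[C]_2) a r c N :
  (forall p v, F (hermitian2 p v) = hermitian2 (a * p + dotr r v) (p *: c + v
    *m N^T)) ->
  map_matrix F = cmx (block_mx a%:M r c^T N : 'M[R]_(1 + 3)).
Proof.
move=> FE; have [M00 M0j Mi0 Mij] := cmx_block_entries a r c N.
have dotd j : dotr r (delta_mx 0 j) = r 0 j.
  rewrite /dotr (bigD1 j) //= mxE !eqxx mulr1 big1 ?addr0 // => k /negPf kj.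
  by rewrite mxE kj andbF mulr0.
have dot0 : dotr r 0 = 0 by rewrite /dotr big1 // => j _; rewrite mxE mulr0.
apply/matrixP; apply: forall_ordS => [|i]; apply: forall_ordS => [|j].
- by rewrite mxE pauli0 FE -pauli0 pauli_coord0 M00 mulr1 dot0 addr0.
- by rewrite mxE pauliS FE pauli_coord0 M0j mulr0 dotd add0r.
- by rewrite mxE pauli0 FE pauli_coordS Mi0 scale1r mul0mx addr0.
- by rewrite mxE pauliS (pauliS R j) FE -pauliS pauli_coordS Mij scale0r add0r
  -rowE !mxE.
Qed.

(** From the anticommutator of w.sigma and v.sigma, which is 2 w.v, and (w.sigma)(v.sigma)(w.sigma)
    = 2 (w.v) w.sigma - |w|^2 v.sigma. *)
Lemma conj_hermitian2 a w p v :
  conj_map (hermitian2 a w) (hermitian2 p v) =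
  hermitian2 ((a ^+ 2 + sqnorm w) * p + 2 * a * dotr w v)
    ((2 * a * p + 2 * dotr w v) *: w + (a ^+ 2 - sqnorm w) *: v).
Proof.
rewrite /conj_map hermitian2_adj sqnormE /dotr !sum3.
set q := (X in _ = hermitian2 X _); set u := (X in _ = hermitian2 _ X).
have [h00 h01 h10 h11] := hermitian2_entries a w.
have [k00 k01 k10 k11] := hermitian2_entries p v.
have [e00 e01 e10 e11] := hermitian2_entries q u.
apply: matrix2P; rewrite !mulmx2E ?e00 ?e01 ?e10 ?e11.
all: rewrite ?h00 ?h01 ?h10 ?h11 ?k00 ?k01 ?k10 ?k11 /u /q !mxE.
all: by apply: complexP => /=; ring.
Qed.

Lemma hermitian2_form p w (z : 'cV[C]_2) (z0 z1 : C) :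
  z 0 0 = z0 -> z 1 0 = z1 ->
  let: a +i* b := z0 in let: c +i* d := z1 in
  (z^t* *m hermitian2 p w *m z) 0 0 =
  (p * (a ^+ 2 + b ^+ 2 + c ^+ 2 + d ^+ 2)
   + w 0 2 * (a ^+ 2 + b ^+ 2 - c ^+ 2 - d ^+ 2)
   + 2 * (w 0 0 * (a * c + b * d) + w 0 1 * (a * d - b * c)))%:C.
Proof.
move=> E0 E1; case: z0 E0 => a b E0; case: z1 E1 => c d E1.
have [h00 h01 h10 h11] := hermitian2_entries p w.
rewrite !mulmx2E.
have zE k : (z^t* ) 0 k = Num.conj (z k 0) by rewrite !mxE.
rewrite !zE E0 E1 h00 h01 h10 h11 !conjE.
by apply: complexP => /=; ring.
Qed.
End Action.

(** * Positivity *)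

Section Positivity.
Variable R : realType.
Local Notation C := R[i].
Implicit Types (v w : 'rV[R]_3) (p a : R).

Lemma hermitian2_hermsymmx p w : hermitian2 p w \is hermsymmx.
Proof. by apply/is_hermitianmxP; rewrite expr0 scale1r hermitian2_adj. Qed.

(* Cayley-Hamilton: [tr(H) <z, H z> = |H z|^2 + det(H) |z|^2]. *)
Lemma hermitian2_form_ge p w (z : 'cV[C]_2) :
  exists2 q : R, (z^t* *m hermitian2 p w *m z) 0 0 = q%:C &
    exists2 n : R, 0 <= n /\ (z != 0 -> 0 < n) &
      (p ^+ 2 - sqnorm w) * n <= 2 * p * q.
Proof.
case E0 : (z 0 0) => [a b]; case E1 : (z 1 0) => [c d].
rewrite (hermitian2_form _ _ E0 E1); eexists; first by [].
exists (a ^+ 2 + b ^+ 2 + c ^+ 2 + d ^+ 2).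
  have n0 : 0 <= a ^+ 2 + b ^+ 2 + c ^+ 2 + d ^+ 2
    by rewrite !addr_ge0 ?sqr_ge0.
  split=> // /eqP z0; rewrite lt_neqAle n0 andbT; apply/eqP => /esym/eqP.
  rewrite !paddr_eq0 ?addr_ge0 ?sqr_ge0 // !sqrf_eq0.
  move=> /andP[/andP[/andP[/eqP a0 /eqP b0] /eqP c0] /eqP d0]; apply: z0.
  apply/colP; apply: forall_ord2; rewrite mxE ?E0 ?E1 ?a0 ?b0 ?c0 ?d0 //.
rewrite sqnormE sum3 -subr_ge0.
rewrite [leRHS](_ : _ =
    ((p + w 0 2) * a + w 0 0 * c + w 0 1 * d) ^+ 2
  + ((p + w 0 2) * b + w 0 0 * d - w 0 1 * c) ^+ 2
  + (w 0 0 * a - w 0 1 * b + (p - w 0 2) * c) ^+ 2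
  + (w 0 0 * b + w 0 1 * a + (p - w 0 2) * d) ^+ 2); last by ring.
by rewrite !addr_ge0 ?sqr_ge0.
Qed.

Lemma psd_hermitian2 p w : 0 < p -> sqnorm w <= p ^+ 2 -> psd (hermitian2 p w).
Proof.
move=> p0 wp; split=> [|z]; first exact: hermitian2_hermsymmx.
have [q -> [n [n0 _] nq]] := hermitian2_form_ge p w z; rewrite ler0c.
have : 0 <= 2 * p * q by apply: le_trans nq; rewrite mulr_ge0 ?subr_ge0.
by rewrite pmulr_rge0 // mulr_gt0.
Qed.

Lemma pd_hermitian2 p w : 0 < p -> sqnorm w < p ^+ 2 -> pd (hermitian2 p w).
Proof.
move=> p0 wp; split=> [|z z0]; first exact: hermitian2_hermsymmx.
have [q -> [n [_ /(_ z0) n0] nq]] := hermitian2_form_ge p w z.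
rewrite -[0]/(0%:C) ltcR.
have : 0 < 2 * p * q by apply: lt_le_trans nq; rewrite mulr_gt0 ?subr_gt0.
by rewrite pmulr_rgt0 // mulr_gt0.
Qed.

(* The columns of the adjugate of [H] give the values
   [H 0 0 * det(H)] and [H 1 1 * det(H)] of the form. *)
Lemma psd_sqnorm_le p w : 0 < p -> psd (hermitian2 p w) -> sqnorm w <= p ^+ 2.
Proof.
move=> p0 [_ H].
pose mk (a b c d : R) : 'cV[C]_2 := \col_(i < 2) (if i == 0 then a +i* b else c
  +i* d).
have mk0 a b c d : mk a b c d 0 0 = a +i* b by rewrite mxE.
have mk1 a b c d : mk a b c d 1 0 = c +i* d by rewrite mxE.
have := H (mk (- w 0 0) (w 0 1) (p + w 0 2) 0).
have := H (mk (p - w 0 2) 0 (- w 0 0) (- w 0 1)).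
rewrite !(hermitian2_form _ _ (mk0 _ _ _ _) (mk1 _ _ _ _)) !ler0c.
rewrite sqnormE sum3 => h1 h2; rewrite -subr_ge0.
rewrite -(pmulr_rge0 _ (_ : 0 < 2 * p)) ?mulr_gt0 //.
apply: (le_trans (addr_ge0 h1 h2)); rewrite le_eqVlt; apply/orP; left.
by apply/eqP; ring.
Qed.

(** The form of A X A* at z is the form of X at A* z. *)
Lemma conj_map_positive (A : 'M[C]_2) : positive_map (conj_map A).
Proof.
move=> X [/is_hermitianmxP XX Xp]; rewrite expr0 scale1r in XX; split.
  apply/is_hermitianmxP; rewrite expr0 scale1r /conj_map.
  by rewrite !trmx_mul !map_mxM trmxCK -XX mulmxA.
move=> z; have := Xp (A^t* *m z).
by rewrite trmx_mul map_mxM trmxCK /conj_map !mulmxA.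
Qed.

Lemma interior_positive_map (Phi : {linear 'M[C]_2 -> 'M[C]_2}) :
  interior_positive Phi -> positive_map Phi.
Proof.
move=> [N PhiN /interior_subset[Psi Psi_pos PsiN]] X /Psi_pos.
by rewrite (map_matrix_inj (etrans PsiN (esym PhiN))).
Qed.

Lemma cmx_inj m n : injective (@cmx R m n).
Proof. by move=> A B /matrixP AB; apply/matrixP => i j; have := AB i j;
  rewrite !mxE => -[]. Qed.

Lemma param_action (Phi : {linear 'M[C]_2 -> 'M[C]_2}) t l :
  map_matrix Phi = cmx (param_matrix t l) ->
  forall p v, Phi (hermitian2 p v) = hermitian2 p (\row_j (p * t 0 j + l 0 j *
    v 0 j)).
Proof.
move=> /map_matrix_action-PhiE p v; rewrite PhiE mul1r.
rewrite [dotr _ _]big1 ?addr0 => [|j _]; last by rewrite mxE mul0r.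
congr hermitian2; apply/rowP => j; rewrite tr_diag_mx mul_mx_diag !mxE.
by rewrite [v 0 j * _]mulrC.
Qed.

(** For a unit vector n the matrix 1 + n.sigma is positive semidefinite, and positivity of its image
    says that the image point lies in the Bloch ball. *)
Lemma param_positive t l : positive_cone (param_matrix t l) ->
  forall n : 'rV[R]_3, \sum_j n 0 j ^+ 2 = 1 ->
     \sum_j (t 0 j + l 0 j * n 0 j) ^+ 2 <= 1.
Proof.
move=> [Psi Psi_pos /param_action PsiE] n n1.
have : psd (Psi (hermitian2 1 n)).
  by apply: Psi_pos; apply: psd_hermitian2; rewrite ?sqnormE ?n1 ?expr1n.
rewrite PsiE => /psd_sqnorm_le-/(_ ltr01); rewrite expr1n sqnormE.
by under eq_bigr do rewrite mxE mul1r.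
Qed.

(** An interior point stays positive when all entries of [t] and [l] are moved away from zero by
    half the radius; this supplies the enlarged map asked for by [secular_lt0]. *)
Lemma interior_secular (Phi : {linear 'M[C]_2 -> 'M[C]_2}) t l :
  interior_positive Phi -> map_matrix Phi = cmx (param_matrix t l) ->
  exists2 s, (forall j, l 0 j ^+ 2 < s) & secular t l s < 0.
Proof.
move=> [N -> intN] /cmx_inj NE; move: intN; rewrite {}NE.
move=> /nbhs_ballP[e /= e0 He].
(* Zero is moved too, so all pushed parameters are nonzero and have strictly larger squares. *)
pose push (a : R) := if 0 <= a then a + e / 2 else a - e / 2.
have pushD a : `|a - push a| < e.
  rewrite /push; case: ifP => _;
    rewrite opprD addrA subrr add0r ?normrN ?opprK gtr0_norm; lra.
have push_sqr a : a ^+ 2 < push a ^+ 2.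
  by rewrite /push; case: ifPn => [a0|]; [nra|rewrite -ltNge => a0; nra].
have push0 a : push a != 0.
  by rewrite -sqrf_eq0 gt_eqF // (le_lt_trans (sqr_ge0 a)).
pose t' : 'rV[R]_3 := map_mx push t; pose l' : 'rV[R]_3 := map_mx push l.
apply: (@secular_lt0 _ t l t' l').
- by move=> j; rewrite mxE.
- by move=> j; rewrite mxE.
- by move=> j; rewrite mxE.
- by move=> j; rewrite mxE ltW.
apply: param_positive; apply: He.
have [p00 p0S pS0 pSS] := block_entries 1 0 t (diag_mx l).
have [q00 q0S qS0 qSS] := block_entries 1 0 t' (diag_mx l').
have near i j : `|param_matrix t l i j - param_matrix t' l' i j| < e.
  rewrite /param_matrix; move: i j; apply: forall_ordS => [|i];
    apply: forall_ordS => [|j].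
  - by rewrite p00 q00 subrr normr0.
  - by rewrite p0S q0S subrr normr0.
  - by rewrite pS0 qS0 mxE.
  - rewrite pSS qSS !mxE; case: eqP => _; first by rewrite !mulr1n.
    by rewrite !mulr0n subrr normr0.
by split=> // i j; exact: near.
Qed.

End Positivity.

(** * Rotations of the Bloch ball *)

Lemma det2 (S : comPzRingType) (A : 'M[S]_2) : \det A = A 0 0 * A 1 1 - A 0 1 *
  A 1 0.
Proof.
rewrite (expand_det_row _ 0) sum2 /cofactor !det_mx11 !mxE.
have -> : lift 0 0 = 1 :> 'I_2 by apply: val_inj.
have -> : lift 1 0 = 0 :> 'I_2 by apply: val_inj.
by rewrite expr0 mul1r expr1 mulN1r mulrN.
Qed.

Section Rotations.
Variable R : realType.
Local Notation C := R[i].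

Lemma householderZ n a (w : 'rV[R]_n) : a != 0 ->
  householder (a *: w) = householder w.
Proof.
move=> a0; have -> : householder (a *: w)
    = 1%:M - (2 / (a ^+ 2 * sqnorm w)) *: (a *: (a *: (w^T *m w))).
  have aw : (a *: w)^T = a *: w^T by rewrite linearZ.
  by rewrite /householder sqnormZ aw -scalemxAl -scalemxAr.
rewrite /householder !scalerA.
have [->|w0] := eqVneq w 0; first by rewrite mulmx0 !scaler0.
by congr (_ - _ *: _); field; rewrite ?a0 ?sqnorm_eq0 ?w0.
Qed.

(* Sylvester: [det(1 - w^T u) = 1 - u w^T], both being the determinant of the
   block matrix [[1, u], [w^T, 1]]. *)
Lemma det_householder n (w : 'rV[R]_n) : w != 0 -> \det (householder w) = -1.
Proof.
rewrite -sqnorm_eq0 => w0; pose u := (2 / sqnorm w) *: w.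
have wE : householder w = 1%:M - w^T *m u by rewrite /householder -scalemxAr.
have uw : u *m w^T = 2%:M.
  by rewrite -scalemxAl mulmx_tr_sqnorm scale_scalar_mx divfK.
have e1 : block_mx 1%:M 0 w^T 1%:M *m block_mx 1%:M u 0 (1%:M - w^T *m u)
    = block_mx (1%:M : 'M[R]_1) u w^T 1%:M.
  by rewrite mulmx_block !(mulmx1, mul1mx, mul0mx, mulmx0, addr0, add0r) addrC
    subrK.
have e2 : block_mx (1%:M - u *m w^T) u 0 1%:M *m block_mx 1%:M 0 w^T 1%:M
    = block_mx (1%:M : 'M[R]_1) u w^T 1%:M.
  by rewrite mulmx_block !(mulmx1, mul1mx, mul0mx, mulmx0, addr0, add0r) subrK.
have := congr1 determinant (etrans e1 (esym e2)).
rewrite !det_mulmx !det_ublock !det_lblock !det1 !mul1r !mulr1 -wE => ->.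
by rewrite uw det_mx11 !mxE eqxx !mulr1n; ring.
Qed.

Lemma conj_map_comp (U V : 'M[C]_2) : conj_map (U *m V) =1 conj_map U \o
  conj_map V.
Proof. by move=> X; rewrite /conj_map /= trmx_mul map_mxM !mulmxA. Qed.

Lemma map_matrix_ext (F G : 'M[C]_2 -> 'M[C]_2) : F =1 G ->
  map_matrix F = map_matrix G.
Proof. by move=> FG; apply/matrixP => i j; rewrite !mxE FG. Qed.

Lemma cmxM m n p (A : 'M[R]_(m, n)) (B : 'M[R]_(n, p)) : cmx (A *m B) = cmx A
  *m cmx B.
Proof. exact: map_mxM. Qed.

Lemma diag1M (P Q : 'M[R]_3) : diag1 (P *m Q) = diag1 P *m diag1 Q.
Proof.
have := mulmx_block (1%:M : 'M[R]_1) 0 0 P 1%:M 0 0 Q.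
by rewrite !(mulmx0, mul0mx, addr0, add0r) mulmx1 => /esym.
Qed.

Lemma unitary_ofM (U V : 'M[C]_2) P Q :
  unitary_of U P -> unitary_of V Q -> unitary_of (U *m V) (P *m Q).
Proof.
move=> [Uu UP] [Vu VQ]; split; first exact: mul_unitarymx.
rewrite (map_matrix_ext (conj_map_comp U V)) map_matrixM UP VQ.
by rewrite diag1M cmxM.
Qed.

Lemma diag1_action (F : 'M[C]_2 -> 'M[C]_2) N :
  (forall p v, F (hermitian2 p v) = hermitian2 p (v *m N^T)) ->
  map_matrix F = cmx (diag1 N).
Proof.
move=> FE; rewrite /diag1 -[X in block_mx 1%:M 0 X N]trmx0;
  apply: map_matrixE => p v.
rewrite FE mul1r scaler0 add0r [dotr _ _]big1 ?addr0 // => j _.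
by rewrite mxE mul0r.
Qed.

(** For a unit vector u, conjugation by u.sigma sends v to 2 (u.v) u - v, the half-turn about u. *)
Lemma lift_half_turn (w : 'rV[R]_3) : w != 0 ->
  exists U, unitary_of U (- householder w).
Proof.
move=> /unit_rescale[a a0 u1]; rewrite -(householderZ w a0).
set u := a *: w in u1 *; exists (hermitian2 0 u); split.
  apply/unitarymxP; have := conj_hermitian2 0 u 1 0.
  rewrite -pauli0 /conj_map mulmx1 => ->.
  rewrite [dotr _ _]big1 => [|j _]; last by rewrite [(0 : 'rV_3) _ _]mxE mulr0.
  by rewrite u1 expr0n !(mulr0, mul0r, addr0, add0r, mulr1, scale0r, scaler0)
    -pauli0.
apply: diag1_action => p v; rewrite conj_hermitian2 u1.
have uv : u *m v^T = (dotr u v)%:M.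
  rewrite [u *m _]mx11_scalar; congr (_%:M); rewrite mxE.
  by apply: eq_bigr => j _; rewrite [v^T _ _]mxE.
have vu : v *m u^T = (dotr u v)%:M
  by rewrite -[LHS]trmxK trmx_mul trmxK uv tr_scalar_mx.
congr hermitian2; first by ring.
rewrite linearN /= trmx_householder /householder u1 opprB mulmxBr mulmx1
  -scalemxAr mulmxA vu.
rewrite mul_scalar_mx scalerA divr1 !(mul0r, mulr0, add0r) expr0n /= sub0r
  scaleN1r.
by [].
Qed.

(** A global phase turns the usual half-angle lift into diag(1, c + i s), which needs only the
    cosine and sine of the full angle. *)
Lemma lift_rotation (Q : 'M[R]_3) (c s : R) : c ^+ 2 + s ^+ 2 = 1 ->
  Q 0 0 = c -> Q 0 1 = - s -> Q 1 0 = s -> Q 1 1 = c ->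
  Q 2 2 = 1 -> Q 0 2 = 0 -> Q 1 2 = 0 -> Q 2 0 = 0 -> Q 2 1 = 0 ->
  exists U, unitary_of U Q.
Proof.
move=> cs q00 q01 q10 q11 q22 q02 q12 q20 q21.
pose U : 'M[C]_2 := \matrix_(i, j)
  (if i != j then 0 else if i == 0 then 1 else c +i* s).
have u00 : U 0 0 = 1 by rewrite mxE.
have u01 : U 0 1 = 0 by rewrite mxE.
have u10 : U 1 0 = 0 by rewrite mxE.
have u11 : U 1 1 = c +i* s by rewrite mxE.
have uc i j : (U^t* ) i j = Num.conj (U j i) by rewrite !mxE.
exists U; split.
  apply/unitarymxP; apply: matrix2P;
    rewrite mulmx2E !uc ?u00 ?u01 ?u10 ?u11 !mxE /=.
  all: rewrite ?rmorph1 ?rmorph0 ?mulr0 ?mul0r ?addr0 ?add0r ?mulr1 ?conjE //.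
  by apply: complexP => /=; [rewrite -cs|]; ring.
apply: diag1_action => p v; rewrite /conj_map.
have [h00 h01 h10 h11] := hermitian2_entries p v.
set u := v *m _.
have [k00 k01 k10 k11] := hermitian2_entries p u.
have uE j : u 0 j = v 0 0 * Q j 0 + v 0 1 * Q j 1 + v 0 2 * Q j 2.
  by rewrite mxE sum3 !mxE.
apply: matrix2P; rewrite !mulmx2E !uc ?u00 ?u01 ?u10 ?u11 ?h00 ?h01 ?h10 ?h11
  ?k00 ?k01 ?k10 ?k11 !uE.
all: rewrite ?q00 ?q01 ?q10 ?q11 ?q02 ?q12 ?q20 ?q21 ?q22 ?rmorph1 ?rmorph0
  ?conjE.
all: apply: complexP => /=; try ring.
transitivity ((c ^+ 2 + s ^+ 2) * (p - v 0 2)); first by ring.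
by rewrite cs; ring.
Qed.

(* A half-turn carries the third row of [Q] to the third basis vector, leaving
   a rotation about the third axis. *)
Lemma lift_so3 (Q : 'M[R]_3) : so3 Q -> exists U, unitary_of U Q.
Proof.
move=> [QQ detQ]; pose e : 'rV[R]_3 := delta_mx 0 2; pose v := e *m Q.
have v1 : sqnorm v = sqnorm (- e).
  rewrite /sqnorm trmx_mul mulmxA -(mulmxA e) QQ mulmx1.
  by rewrite linearN /= mulmxN mulNmx opprK.
(* The reflection along v + e takes v to -e, so its negative takes v to e. If v = -e that axis
   degenerates, and a half-turn about the first basis vector, orthogonal to e, serves instead. *)
have [w w0 vw] : exists2 w, w != 0 & v *m - householder w = e.
  have [|w0] := eqVneq (v - - e) 0.
    rewrite opprK => /eqP; rewrite addr_eq0 => /eqP ->.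
    pose d : 'rV[R]_3 := delta_mx 0 0; exists d.
      by rewrite -sqnorm_eq0 unit_delta oner_eq0.
    rewrite mulNmx mulmxN opprK /householder mulmxBr mulmx1 -scalemxAr mulmxA.
    by rewrite trmx_delta mul_delta_mx_0 // mul0mx scaler0 subr0.
  by exists (v - - e) => //; rewrite mulmxN householder_reflect // opprK.
have [W WH] := lift_half_turn w0.
set H := - householder w in vw WH.
have HT : H^T = H by rewrite linearN /= trmx_householder.
have HH : H *m H = 1%:M.
  rewrite mulNmx mulmxN opprK -{2}[householder w]trmx_householder.
  exact: householder_orthogonal.
have detH : \det H = 1.
  by rewrite /H -scaleN1r detZ det_householder //; ring.
pose T := Q *m H.
have TT : T *m T^T = 1%:M.
  by rewrite trmx_mul mulmxA -(mulmxA Q) HT HH mulmx1.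
have detT : \det T = 1 by rewrite det_mulmx detQ detH mulr1.
have T2 j : T 2 j = (j == 2)%:R.
  by have /rowP/(_ j) := vw; rewrite -mulmxA -rowE !mxE eqxx.
have dot_rows i j : \sum_k T i k * T j k = (i == j)%:R.
  have /matrixP/(_ i j) := TT; rewrite !mxE => <-.
  by apply: eq_bigr => k _; rewrite [T^T _ _]mxE.
have Ti2 i : i != 2 -> T i 2 = 0.
  move=> /negPf i2; have := dot_rows i 2; rewrite sum3 !T2 /= i2.
  by rewrite !mulr0 !add0r mulr1.
have T02 : T 0 2 = 0 by apply: Ti2.
have T12 : T 1 2 = 0 by apply: Ti2.
have r00 := dot_rows 0 0; have r01 := dot_rows 0 1.
rewrite !sum3 T02 T12 /= !mulr0 !addr0 in r00 r01.
have d2 : T 0 0 * T 1 1 - T 0 1 * T 1 0 = 1.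
  rewrite -detT (expand_det_row _ 2) sum3 !T2 /= !mul0r !add0r mul1r /cofactor.
  rewrite det2 !mxE -signr_odd /= expr0 mul1r.
  have -> : lift 2 0 = 0 :> 'I_3 by apply: val_inj.
  by have -> : lift 2 1 = 1 :> 'I_3 by apply: val_inj.
(* An orthogonal 2 by 2 block of determinant 1 equals its cofactor matrix; the polynomial identities
   add suitable multiples of the known relations. *)
have T11 : T 1 1 = T 0 0.
  transitivity (T 0 0 * (T 0 0 * T 1 1 - T 0 1 * T 1 0)
    + T 1 1 * (1 - (T 0 0 * T 0 0 + T 0 1 * T 0 1))
    + T 0 1 * (T 0 0 * T 1 0 + T 0 1 * T 1 1)); first by ring.
  by rewrite d2 r00 r01; ring.
have T01 : T 0 1 = - T 1 0.
  transitivity (T 0 1 * (1 - (T 0 0 * T 1 1 - T 0 1 * T 1 0))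
    + T 0 0 * (T 0 0 * T 1 0 + T 0 1 * T 1 1)
    - T 1 0 * (T 0 0 * T 0 0 + T 0 1 * T 0 1)); first by ring.
  by rewrite d2 r00 r01; ring.
have cs : T 0 0 ^+ 2 + T 1 0 ^+ 2 = 1 by rewrite -[RHS]r00 T01; ring.
have [V VT] : exists V, unitary_of V T.
  by apply: (lift_rotation cs) => //; rewrite T2.
exists (V *m W); rewrite (_ : Q = T *m H); first exact: unitary_ofM.
by rewrite -mulmxA HH mulmx1.
Qed.

End Rotations.

(** * The normal form *)

Section NormalForm.
Variable R : realType.
Local Notation C := R[i].

(** In odd dimension, multiplying an orthogonal matrix by its determinant makes the determinant 1;
    the signs go into [d], whose entries may thus be negative. *)
Lemma svd_so3 (M : 'M[R]_3) : exists (P Q : 'M[R]_3) (d : 'rV[R]_3),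
  [/\ so3 P, so3 Q & M = P *m diag_mx d *m Q].
Proof.
have [P [Q [d [PP QQ MPQ]]]] := singular_value_decomposition M.
have pos (A : 'M[R]_3) : orthogonalmx A -> so3 (\det A *: A).
  move=> AA; have dA := det_orthogonalmx AA; split; last first.
    rewrite detZ; transitivity ((\det A * \det A) * (\det A * \det A));
      first by ring.
    by rewrite dA mulr1.
  by rewrite linearZ /= -scalemxAl -scalemxAr scalerA dA AA scale1r.
exists (\det P *: P), (\det Q *: Q), ((\det P * \det Q) *: d); split;
  try exact: pos.
have dE : diag_mx ((\det P * \det Q) *: d) = (\det P * \det Q) *: diag_mx d.
  by rewrite linearZ.
rewrite dE -scalemxAl -scalemxAl -scalemxAr -scalemxAr -scalemxAl !scalerA -MPQ.
rewrite -[LHS]scale1r; congr (_ *: _); apply: esym.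
transitivity ((\det P * \det P) * (\det Q * \det Q)); first by ring.
by rewrite !det_orthogonalmx // mulr1.
Qed.

(** Conjugation by the adjoint inverts conjugation by [U], and the inverse of [Q] is its
    transpose. *)
Lemma unitary_of_adj (U : 'M[C]_2) Q : so3 Q -> unitary_of U Q ->
  map_matrix (conj_map (U^t* )) = cmx (diag1 Q^T).
Proof.
move=> [QQ _] [/unitarymxP/mulmx1C UU UQ].
have E : map_matrix (conj_map (U^t* ) \o conj_map U) = cmx (diag1 1%:M).
  apply: diag1_action => p v; rewrite trmx1 mulmx1 -conj_map_comp UU.
  by rewrite /conj_map mul1mx trmx1 map_mx1 mulmx1.
rewrite map_matrixM UQ in E.
have I4 : cmx (diag1 (1%:M : 'M[R]_3)) = 1%:M.
  by rewrite /diag1 -scalar_mx_block; exact: map_mx1.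
by rewrite -[LHS]mulmx1 -I4 -QQ diag1M cmxM mulmxA E I4 mul1mx.
Qed.

Lemma map_matrix_unitary_conj (F : {linear 'M[C]_2 -> 'M[C]_2}) (U V : 'M[C]_2)
    P Q N :
  so3 P -> unitary_of U P -> so3 Q -> unitary_of V Q ->
  map_matrix F = cmx (diag1 N) ->
  map_matrix (conj_map (U^t* ) \o F \o conj_map (V^t* ))
    = cmx (diag1 (P^T *m N *m Q^T)).
Proof.
move=> P3 UP Q3 VQ FN; rewrite map_matrixM map_matrixM FN.
by rewrite (unitary_of_adj P3 UP) (unitary_of_adj Q3 VQ) -!cmxM -!diag1M.
Qed.

Lemma diag1_unital (F : 'M[C]_2 -> 'M[C]_2) N :
  map_matrix F = cmx (diag1 N) -> unital_map F.
Proof.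
rewrite /diag1 -[X in block_mx 1%:M 0 X N]trmx0 => FN.
have [M00 _ Mi0 _] := cmx_block_entries 1 0 0 N.
rewrite /unital_map -[1%:M]/(pauli R 0); apply: pauli_coord_inj => k.
have -> : 2^-1 * \tr (pauli R k *m F (pauli R 0)) = map_matrix F k 0
  by rewrite mxE.
rewrite FN pauli0; move: k; apply: forall_ordS => [|i].
  by rewrite M00 pauli_coord0.
by rewrite Mi0 pauli_coordS.
Qed.

Lemma diag1_trace_preserving (F : {linear 'M[C]_2 -> 'M[C]_2}) N :
  map_matrix F = cmx (diag1 N) -> trace_preserving F.
Proof.
rewrite /diag1 -[X in block_mx 1%:M 0 X N]trmx0 => FN X.
have [M00 M0j _ _] := cmx_block_entries 1 0 0 N.
apply: (mulfI (_ : 2^-1 != 0 :> C)); first by rewrite invr_eq0 pnatr_eq0.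
have coef k : 2^-1 * \tr (F (pauli R k)) = map_matrix F 0 k.
  by rewrite mxE -[pauli R 0]/(1%:M) mul1mx.
rewrite {1}[X]pauli_expansion linear_sum raddf_sum mulr_sumr.
under eq_bigr do rewrite linearZ /= mxtraceZ mulrCA coef FN.
rewrite big_ord_recl M00 mulr1 mul1mx big1 ?addr0 // => j _.
by rewrite M0j mxE mulr0.
Qed.

Lemma hermitian2Z a b (f : 'I_3 -> R) :
  a%:C *: 1%:M + b%:C *: \sum_j (f j)%:C *: pauli R (lift ord0 j)
  = hermitian2 a (b *: \row_j f j).
Proof.
rewrite /hermitian2 scaler_sumr; congr (_ + _); apply: eq_bigr => j _.
by rewrite scalerA !mxE rmorphM.
Qed.

Lemma dotrZl a (u v : 'rV[R]_3) : dotr (a *: u) v = a * dotr u v.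
Proof. by rewrite /dotr mulr_sumr; apply: eq_bigr => j _;
  rewrite mxE mulrA. Qed.

(* Conjugation by the square root of [1 + u.sigma], written as in [tildeA]. *)
Lemma conj_sqrt_action (u : 'rV[R]_3) n p v : sqnorm u = n ^+ 2 -> 0 < n < 1 ->
  conj_map (hermitian2 ((Num.sqrt (1 + n) + Num.sqrt (1 - n)) / 2)
      (((Num.sqrt (1 + n) - Num.sqrt (1 - n)) / (2 * n)) *: u)) (hermitian2 p v)
  = hermitian2 (p + dotr u v)
      (p *: u + Num.sqrt (1 - n ^+ 2) *: v
       + ((1 - Num.sqrt (1 - n ^+ 2)) / n ^+ 2 * dotr u v) *: u).
Proof.
move=> un /andP[n0 n1]; rewrite conj_hermitian2 dotrZl sqnormZ un.
have nn : n != 0 by rewrite gt_eqF.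
have PP : Num.sqrt (1 + n) ^+ 2 = 1 + n by rewrite sqr_sqrtr //; lra.
have MM : Num.sqrt (1 - n) ^+ 2 = 1 - n by rewrite sqr_sqrtr //; lra.
have -> : Num.sqrt (1 - n ^+ 2) = Num.sqrt (1 + n) * Num.sqrt (1 - n).
  by rewrite -sqrtrM; [congr Num.sqrt; ring|lra].
move: PP MM; set P := Num.sqrt (1 + n); set M := Num.sqrt (1 - n) => PP MM.
set a := (P + M) / 2; set b := (P - M) / (2 * n); set d := dotr u v.
(* [P] = a + b n and [M] = a - b n are the eigenvalues of the conjugating matrix, so the
   coefficients of the action are simple expressions in them. *)
have f1 : a ^+ 2 + b ^+ 2 * n ^+ 2 = 1.
  transitivity ((P ^+ 2 + M ^+ 2) / 2); first by rewrite /a /b; field.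
  by rewrite PP MM; field.
have f2 : 2 * a * b = 1.
  transitivity ((P ^+ 2 - M ^+ 2) / (2 * n)); first by rewrite /a /b; field.
  by rewrite PP MM; field.
have f3 : a ^+ 2 - b ^+ 2 * n ^+ 2 = P * M by rewrite /a /b; field.
have f4 : (1 - P * M) / n ^+ 2 = 2 * b ^+ 2.
  transitivity (((P ^+ 2 + M ^+ 2) / 2 - P * M) / n ^+ 2); last by rewrite /b;
    field.
  by rewrite PP MM; field.
congr hermitian2; first by rewrite f1 mul1r mulrA f2 mul1r.
apply/rowP => j; rewrite !mxE f3 f4.
transitivity (p * (2 * a * b) * u 0 j + P * M * v 0 j + 2 * b ^+ 2 * d * u 0 j).
  by ring.
by rewrite f2 mulr1.
Qed.

(* Conjugation by the inverse square root of [y + z.sigma], written as in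
   [tildeB]; for [m = 0] the vector [z] vanishes and so do the 0/0 terms. *)
Lemma conj_invsqrt_action (z : 'rV[R]_3) y m p v :
  sqnorm z = m ^+ 2 -> 0 <= m < y ->
  let D := Num.sqrt (y ^+ 2 - m ^+ 2) in
  conj_map (hermitian2 ((Num.sqrt (y + m) + Num.sqrt (y - m)) / (2 * D))
      (- ((Num.sqrt (y + m) - Num.sqrt (y - m)) / (2 * m * D)) *: z))
        (hermitian2 p v)
  = hermitian2 ((y * p - dotr z v) / D ^+ 2)
      ((- (p / D ^+ 2)) *: z + D^-1 *: v + (dotr z v / ((y + D) * D ^+ 2)) *:
        z).
Proof.
move=> zm /andP[m0 my] D; rewrite conj_hermitian2 dotrZl sqnormZ zm.
have y0 : 0 < y by exact: le_lt_trans my.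
have PP : Num.sqrt (y + m) ^+ 2 = y + m by rewrite sqr_sqrtr //; lra.
have MM : Num.sqrt (y - m) ^+ 2 = y - m by rewrite sqr_sqrtr //; lra.
have DPM : D = Num.sqrt (y + m) * Num.sqrt (y - m).
  by rewrite -sqrtrM; [congr Num.sqrt; ring|lra].
have D0 : 0 < D by rewrite sqrtr_gt0; nra.
move: PP MM DPM; set P := Num.sqrt (y + m);
  set M := Num.sqrt (y - m) => PP MM DPM.
have P0 : 0 < P by rewrite sqrtr_gt0; lra.
have M0 : 0 < M by rewrite sqrtr_gt0; lra.
clearbody D P M.
have [Dn yDn] : D != 0 /\ y + D != 0 by rewrite !gt_eqF ?addr_gt0.
set a := (P + M) / (2 * D); set b := (P - M) / (2 * m * D); set d := dotr z v.
have [m_eq0|mn] := eqVneq m 0.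
  have z0 : z = 0 by apply/eqP; rewrite -sqnorm_eq0 zm m_eq0 expr0n.
  have d0 : d = 0 by rewrite /d z0 /dotr big1 // => j _; rewrite mxE mul0r.
  have PM : P = M.
    apply/eqP; rewrite -(eqrXn2 (n := 2)) ?ltW //.
    by rewrite PP MM m_eq0 addr0 subr0.
  have aE : a ^+ 2 = D^-1 by rewrite /a DPM PM; field; rewrite gt_eqF.
  have yD : y = D by rewrite DPM -PM -expr2 PP m_eq0 addr0.
  rewrite d0 z0 m_eq0 !scaler0 aE yD; congr hermitian2; first by field.
  by rewrite !(expr0n, mulr0, subr0, addr0, add0r).
have f1 : a ^+ 2 + (- b) ^+ 2 * m ^+ 2 = y / D ^+ 2.
  transitivity ((P ^+ 2 + M ^+ 2) / 2 / D ^+ 2); first by rewrite /a /b;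
    field; rewrite Dn mn.
  by rewrite PP MM; field.
have f2 : 2 * a * b = D ^- 2.
  transitivity ((P ^+ 2 - M ^+ 2) / (2 * m * D ^+ 2)); first by rewrite /a /b;
    field; rewrite Dn mn.
  by rewrite PP MM; field; rewrite Dn mn.
have f3 : a ^+ 2 - (- b) ^+ 2 * m ^+ 2 = D^-1.
  transitivity (P * M / D ^+ 2); first by rewrite /a /b; field; rewrite Dn mn.
  by rewrite -DPM; field.
(* Rationalisation: (y - D) / m^2 becomes 1 / (y + D), which stays regular at m = 0. *)
have mE : m ^+ 2 = (y - D) * (y + D).
  rewrite -subr_sqr {1}DPM exprMn PP MM; ring.
have f4 : ((y + D) * D ^+ 2)^-1 = 2 * b ^+ 2.
  transitivity ((y - D) / (m ^+ 2 * D ^+ 2)).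
    have : m ^+ 2 != 0 by rewrite expf_neq0.
    rewrite mE mulf_eq0 negb_or => /andP[h1 h2].
    by field; rewrite h1 h2 Dn.
  transitivity (((P ^+ 2 + M ^+ 2) / 2 - P * M) / (m ^+ 2 * D ^+ 2)).
    by rewrite PP MM -DPM; field; rewrite Dn mn.
  by rewrite /b; field; rewrite Dn mn.
congr hermitian2.
  rewrite f1; transitivity (y / D ^+ 2 * p - (2 * a * b) * d); first by ring.
  by rewrite f2; field.
apply/rowP => j; rewrite !mxE f3 f4.
transitivity (- p * (2 * a * b) * z 0 j + D^-1 * v 0 j + 2 * b ^+ 2 * d * z 0
  j).
  by ring.
by rewrite f2; ring.
Qed.
End NormalForm.

(** * Reduction at a root of the secular equation above all poles *)

Section Reduction.
Variable R : realType.
Local Notation C := R[i].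
Variables (t l : 'rV[R]_3) (y : R).
Hypothesis ly : forall j, l 0 j ^+ 2 < y.
Hypothesis gy : secular t l y = 0.
Hypothesis slope_gt0 : 0 < secular_slope t l y.

Local Notation x := (xnorm t l y).
Local Notation m := (xi t l y).
Local Notation X := (\row_j xvec t l y j).
Local Notation Z := (\row_j (l 0 j * xvec t l y j)).

Lemma y_gt0 : 0 < y. Proof. exact: le_lt_trans (sqr_ge0 _) (ly 0). Qed.

Lemma pole_neq0 j : l 0 j ^+ 2 - y != 0.
Proof. by rewrite subr_eq0 lt_eqF. Qed.

Lemma xvec_eq j : l 0 j ^+ 2 * xvec t l y j = y * (xvec t l y j + t 0 j).
Proof. by rewrite /xvec; field; rewrite pole_neq0. Qed.

Lemma sqr_xnorm : x ^+ 2 = \sum_j xvec t l y j ^+ 2.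
Proof. by rewrite sqr_sqrtr // sumr_ge0 // => j _; rewrite sqr_ge0. Qed.

Lemma sqr_xi : m ^+ 2 = \sum_j l 0 j ^+ 2 * xvec t l y j ^+ 2.
Proof.
by rewrite sqr_sqrtr // sumr_ge0 // => j _; rewrite mulr_ge0 ?sqr_ge0.
Qed.

Lemma sum_t_xvec : \sum_j xvec t l y j * t 0 j = y - 1.
Proof.
have /eqP := gy; rewrite /secular addr_eq0 => /eqP ->.
rewrite -sumrN; apply: eq_bigr => j _; rewrite /xvec; field.
by rewrite pole_neq0 -opprB oppr_eq0 pole_neq0.
Qed.

(** Multiply [xvec_eq] by x_j, sum over j and insert [sum_t_xvec]. *)
Lemma sqr_xi_xnorm : y ^+ 2 - m ^+ 2 = y * (1 - x ^+ 2).
Proof.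
suff -> : m ^+ 2 = y * x ^+ 2 + y * (y - 1) by ring.
rewrite sqr_xi sqr_xnorm -sum_t_xvec !mulr_sumr -big_split;
  apply: eq_bigr => j _ /=.
by rewrite [xvec _ _ _ _ ^+ 2]expr2 mulrA xvec_eq; ring.
Qed.

(** The definition of x_j gives xi^2 = y^2 (1 - slope), and the slope is positive. *)
Lemma xi_bounds : 0 <= m < y.
Proof.
have y0 := y_gt0; rewrite sqrtr_ge0 /= -(ltr_pXn2r (n := 2)) ?nnegrE ?sqrtr_ge0
  ?ltW //.
rewrite sqr_xi (_ : \sum_j _ = y ^+ 2 * (1 - secular_slope t l y)).
  by rewrite gtr_pMr ?exprn_gt0 // gtrBl.
rewrite /secular_slope subKr mulr_sumr; apply: eq_bigr => j _; rewrite /xvec.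
by field; rewrite pole_neq0 -opprB oppr_eq0 pole_neq0.
Qed.

Lemma xnorm_bounds : t != 0 -> 0 < x < 1.
Proof.
move=> t0; have y0 := y_gt0; apply/andP; split.
  have [/existsP[j tj]|/existsPn t_eq0] := boolP [exists j, t 0 j != 0];
    last first.
    case/eqP: t0; apply/rowP => j; rewrite mxE; apply/eqP.
    by have := t_eq0 j; rewrite negbK.
  rewrite sqrtr_gt0 (bigD1 j) //= ltr_pwDl ?sumr_ge0 // => [|k _];
    last exact: sqr_ge0.
  have xn : xvec t l y j != 0.
    by rewrite /xvec mulf_neq0 ?invr_eq0 ?pole_neq0 // mulf_neq0 // gt_eqF.
  by rewrite lt_def sqr_ge0 sqrf_eq0 xn.
have /andP[m0 my] := xi_bounds.
rewrite -(ltr_pXn2r (n := 2)) ?nnegrE ?sqrtr_ge0 // expr1n -subr_gt0.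
by rewrite -(pmulr_rgt0 _ y0) -sqr_xi_xnorm; nra.
Qed.

Hypothesis t_neq0 : t != 0.

Let D := Num.sqrt (y ^+ 2 - m ^+ 2).
Let k := Num.sqrt (1 - x ^+ 2).

Lemma sqnorm_X : sqnorm X = x ^+ 2.
Proof. by rewrite sqnormE sqr_xnorm; apply: eq_bigr => j _; rewrite mxE. Qed.

Lemma sqnorm_Z : sqnorm Z = m ^+ 2.
Proof. by rewrite sqnormE sqr_xi; apply: eq_bigr => j _;
  rewrite mxE exprMn. Qed.

Lemma tildeA_hermitian2 : tildeA t l y
  = hermitian2 ((Num.sqrt (1 + x) + Num.sqrt (1 - x)) / 2)
      (((Num.sqrt (1 + x) - Num.sqrt (1 - x)) / (2 * x)) *: X).
Proof. by rewrite -hermitian2Z. Qed.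

Lemma tildeB_hermitian2 : tildeB t l y
  = hermitian2 ((Num.sqrt (y + m) + Num.sqrt (y - m)) / (2 * D))
      (- ((Num.sqrt (y + m) - Num.sqrt (y - m)) / (2 * m * D)) *: Z).
Proof. by rewrite -hermitian2Z rmorphN scaleNr. Qed.

Lemma pd_tildeA : pd (tildeA t l y).
Proof.
have /andP[x0 x1] := xnorm_bounds t_neq0.
have xn : x != 0 by rewrite gt_eqF.
rewrite tildeA_hermitian2; move: (sqnorm_X).
have p0 : 0 < Num.sqrt (1 + x) by rewrite sqrtr_gt0; lra.
have m0 : 0 < Num.sqrt (1 - x) by rewrite sqrtr_gt0; lra.
set P := Num.sqrt (1 + x) in p0 *; set M := Num.sqrt (1 - x) in m0 * => nX.
apply: pd_hermitian2; first by lra.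
rewrite sqnormZ nX -subr_gt0.
(* The determinant is the product of the eigenvalues [P] and [M]. *)
by rewrite [ltRHS](_ : _ = P * M) ?mulr_gt0 //; field.
Qed.

Lemma D_gt0 : 0 < D.
Proof. by have /andP[m0 my] := xi_bounds; rewrite sqrtr_gt0; nra. Qed.

Lemma k_gt0 : 0 < k.
Proof. by have /andP[x0 x1] := xnorm_bounds t_neq0; rewrite sqrtr_gt0; nra. Qed.

Lemma pd_tildeB : pd (tildeB t l y).
Proof.
have /andP[m0 my] := xi_bounds; have D0 := D_gt0.
have y0 := y_gt0; have Dn : D != 0 by rewrite gt_eqF.
rewrite tildeB_hermitian2; move: (sqnorm_Z).
have p0 : 0 < Num.sqrt (y + m) by rewrite sqrtr_gt0; lra.
have M0 : 0 < Num.sqrt (y - m) by rewrite sqrtr_gt0; lra.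
set P := Num.sqrt (y + m) in p0 *; set M := Num.sqrt (y - m) in M0 * => nZ.
have a0 : 0 < (P + M) / (2 * D) by rewrite divr_gt0 ?addr_gt0 ?mulr_gt0.
apply: pd_hermitian2 => //.
rewrite sqnormZ nZ; have [->|mn] := eqVneq m 0.
  by rewrite expr0n mulr0 exprn_gt0.
rewrite -subr_gt0 [ltRHS](_ : _ = P * M / D ^+ 2) ?divr_gt0 ?mulr_gt0 //.
by field; rewrite Dn mn.
Qed.

(** Rationalised as in [conj_invsqrt_action], so that xi = 0 needs no separate formula: there all
    l_j x_j vanish, and with them the rank-one term. *)
Lemma reduced_action v j : (v *m (reduced_matrix t l y)^T) 0 j =
  k ^+ 2 / D * (l 0 j * v 0 j / k
    + ((1 - k) / (x ^+ 2 * D) - l 0 j ^+ 2 / ((y + D) * k * y))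
      * xvec t l y j * dotr Z v).
Proof.
have y0 := y_gt0; have D0 := D_gt0; have k0 := k_gt0.
have /andP[x0 x1] := xnorm_bounds t_neq0; have /andP[m0 my] := xi_bounds.
have kk : 1 - x ^+ 2 = k ^+ 2 by rewrite [RHS]sqr_sqrtr //; nra.
have DD : D ^+ 2 = y ^+ 2 - m ^+ 2 by rewrite [LHS]sqr_sqrtr //; nra.
have [dn|dn] := eqVneq m 0; last first.
  have -> : l 0 j ^+ 2 / ((y + D) * k * y)
      = (y - D) * l 0 j ^+ 2 / (m ^+ 2 * k * y).
    have : m ^+ 2 != 0 by rewrite expf_neq0.
    have -> : m ^+ 2 = (y - D) * (y + D) by rewrite -subr_sqr DD subKr.
    rewrite mulf_eq0 negb_or => /andP[h1 h2].
    by field; rewrite h1 h2 !gt_eqF.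
  rewrite mxE /dotr !sum3 !mxE -/D -/k kk.
  set c1 := (X in (X - _) * _); set c2 := (X in (_ - X) * _).
  by move: j @c2; apply: forall_ord3 => /=; ring.
have Z0 i : l 0 i * xvec t l y i = 0.
  have /eqP : Z = 0 by apply/eqP; rewrite -sqnorm_eq0 sqnorm_Z dn expr0n.
  by move=> /eqP/rowP/(_ i); rewrite !mxE.
rewrite [dotr _ _]big1 => [|i _]; last by rewrite mxE Z0 mul0r.
rewrite mxE sum3 !mxE -/D -/k kk.
rewrite -!(mulrA _ (l 0 _) (xvec _ _ _ _)) !Z0 !mulr0 !addr0.
by move: j; apply: forall_ord3 => /=; ring.
Qed.

Lemma map_matrix_reduced (Phi : {linear 'M[C]_2 -> 'M[C]_2}) :
  map_matrix Phi = cmx (param_matrix t l) ->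
  map_matrix (conj_map (tildeA t l y) \o Phi \o conj_map (tildeB t l y))
    = cmx (diag1 (reduced_matrix t l y)).
Proof.
move=> /param_action-PhiE; apply: diag1_action => p v /=.
have y0 := y_gt0; have D0 := D_gt0; have k0 := k_gt0.
have xb := xnorm_bounds t_neq0; have mb := xi_bounds.
rewrite tildeA_hermitian2 tildeB_hermitian2 (conj_invsqrt_action _ _ sqnorm_Z
  mb) -/D.
rewrite PhiE (conj_sqrt_action _ _ sqnorm_X xb) -/k.
have {xb} /andP[x0 x1] := xb; have {mb} /andP[m0 my] := mb.
have kk : k ^+ 2 = 1 - x ^+ 2 by rewrite [LHS]sqr_sqrtr //; nra.
have DD : D ^+ 2 = y ^+ 2 - m ^+ 2 by rewrite [LHS]sqr_sqrtr //; nra.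
have Dy : D ^+ 2 = y * k ^+ 2 by rewrite DD kk sqr_xi_xnorm.
have qE : dotr Z v = \sum_j l 0 j * xvec t l y j * v 0 j.
  by apply: eq_bigr => j _; rewrite mxE.
move: qE; set q := dotr Z v; have dq : dotr Z v = q by [].
clearbody q => qE; set p1 := (y * p - q) / D ^+ 2.
set v1 := (_ + _ + _ : 'rV_3); set v2 := (\row_j (p1 * _ + _)).
have [Dn [yn kn]] : D != 0 /\ y != 0 /\ k != 0 by rewrite !gt_eqF.
have yDn : y + D != 0 by rewrite gt_eqF ?addr_gt0.
have zz : \sum_j (l 0 j * xvec t l y j) * (l 0 j * xvec t l y j) = (y - D) * (y
  + D).
  by rewrite -subr_sqr DD subKr sqr_xi; apply: eq_bigr => j _; ring.
(* The scalar coordinate after the last conjugation is p1 + x.v2; this shows that the composite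
   leaves p unchanged. *)
have xv2 : dotr X v2 = p - p1.
  have -> : dotr X v2 = p1 * \sum_j xvec t l y j * t 0 j
     + (- (p / D ^+ 2) * (\sum_j (l 0 j * xvec t l y j) * (l 0 j * xvec t l y
       j))
        + D^-1 * (\sum_j l 0 j * xvec t l y j * v 0 j)
        + q / ((y + D) * D ^+ 2) * (\sum_j (l 0 j * xvec t l y j) * (l 0 j *
          xvec t l y j))).
    rewrite /dotr !mulr_sumr -!big_split; apply: eq_bigr => j _ /=.
    by rewrite !mxE; ring.
  by rewrite sum_t_xvec zz -qE /p1; field; rewrite Dn yDn.
rewrite xv2 addrC subrK; congr hermitian2; apply/rowP => j.
rewrite reduced_action dq.
(* The vector coordinates are compared after eliminating [t] here and [y] by D^2 = y k^2; a rational
   identity in independent quantities remains. *)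
have tE : t 0 j = l 0 j ^+ 2 * xvec t l y j / y - xvec t l y j.
  by rewrite xvec_eq; field.
have kk1 : (1 - k) / x ^+ 2 = (1 + k)^-1.
  have : x ^+ 2 != 0 by rewrite expf_neq0 // gt_eqF.
  have -> : x ^+ 2 = (1 - k) * (1 + k) by rewrite -subr_sqr expr1n kk subKr.
  by rewrite mulf_eq0 negb_or => /andP[h1 h2]; field; rewrite h1 h2.
have kk2 : (1 - k) / (x ^+ 2 * D) = (1 + k)^-1 / D.
  by rewrite -kk1 invfM mulrA.
rewrite kk2 kk1 !mxE /p1 tE.
have yE : y = D ^+ 2 / k ^+ 2 by rewrite Dy mulfK // expf_neq0.
have k1 : 1 + k != 0 by rewrite gt_eqF ?addr_gt0.
have Dk : D + k ^+ 2 != 0 by rewrite gt_eqF ?addr_gt0 ?exprn_gt0.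
move: (l 0 j) (xvec t l y j) (v 0 j) => L Xj V.
rewrite yE.
by field; rewrite Dn kn k1 gt_eqF // addr_gt0 ?mulr_gt0 ?exprn_gt0.
Qed.

End Reduction.

Theorem proposition4 (R : realType)
  (Phi : {linear 'M[R[i]]_2 -> 'M[R[i]]_2}) (t l : 'rV[R]_3)
  (nonunital : ~ unital_map Phi)
  (interior_Phi : interior_positive Phi)
  (matrix_Phi : map_matrix Phi = cmx (param_matrix t l)) :
  (exists y : R, largest_root t l y) /\
  forall y : R, largest_root t l y ->
  let x := xnorm t l y in
  let xi := xi t l y in
  let tA := tildeA t l y in
  let tB := tildeB t l y in
  let Psi := conj_map tA \o Phi \o conj_map tB in
  let M := reduced_matrix t l y in
  [/\ (forall j, l 0 j ^+ 2 - y != 0) /\ 0 < x < 1 /\ 0 <= xi < y,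
      pd tA /\ pd tB,
      [/\ unital_map Psi, positive_map Psi & trace_preserving Psi],
      map_matrix Psi = cmx (diag1 M) &
      (exists (QU QV : 'M[R]_3) (tl : 'rV[R]_3),
         [/\ so3 QU, so3 QV & M = QU *m diag_mx tl *m QV]) /\
      forall (QU QV : 'M[R]_3) (tl : 'rV[R]_3),
        so3 QU -> so3 QV -> M = QU *m diag_mx tl *m QV ->
        [/\ exists U : 'M[R[i]]_2, unitary_of U QU,
            exists V : 'M[R[i]]_2, unitary_of V QV &
            forall U V : 'M[R[i]]_2, unitary_of U QU -> unitary_of V QV ->
              let A := U^t* *m tA in
              let B := tB *m V^t* in
              let Upsilon := conj_map A \o Phi \o conj_map B in
              unital_map Upsilon /\
              map_matrix Upsilon = cmx (diag1 (diag_mx tl))]].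
Proof.
have [s ls gs] := interior_secular interior_Phi matrix_Phi.
(* A vanishing translation would make [Phi] fix the identity. *)
have t0 : t != 0.
  apply/eqP => t_eq0; apply: nonunital; rewrite /unital_map.
  rewrite -[1%:M]/(pauli R 0) pauli0 (param_action matrix_Phi).
  by congr hermitian2; apply/rowP => j; rewrite t_eq0 !mxE !mulr0 addr0.
split=> [|y y_max]; first exact: largest_root_exists gs.
have [sy gy slope0] := largest_root_above ls gs y_max.
have ly j : l 0 j ^+ 2 < y by exact: lt_trans (ls j) sy.
move=> x xi tA tB Psi M.
have PsiM : map_matrix Psi = cmx (diag1 M) by exact: map_matrix_reduced.
have Phi_pos := interior_positive_map interior_Phi.
split=> //.
- by split; [exact: pole_neq0|split; [exact: xnorm_bounds|exact: xi_bounds]].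
- by split; [exact: pd_tildeA|exact: pd_tildeB].
- split; first exact: diag1_unital PsiM.
    by move=> X /(conj_map_positive tB)/Phi_pos/(conj_map_positive tA).
  exact: (@diag1_trace_preserving _ Psi M).
split; first exact: svd_so3.
move=> P Q d P3 Q3 MPQ; split; [exact: lift_so3|exact: lift_so3|].
move=> U V UP VQ A B Upsilon.
suff UpsM : map_matrix Upsilon = cmx (diag1 (diag_mx d)).
  by split=> //; exact: diag1_unital UpsM.
have UpsE : Upsilon =1 (conj_map (U^t* ) \o Psi) \o conj_map (V^t* ).
  by move=> X; rewrite /Upsilon /Psi /= !conj_map_comp.
rewrite (map_matrix_ext UpsE) (map_matrix_unitary_conj P3 UP Q3 VQ PsiM) MPQ.
have [PP QQ] : P^T *m P = 1%:M /\ Q *m Q^T = 1%:M.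
  by split; [apply: mulmx1C; case: P3|case: Q3].
by rewrite !mulmxA PP mul1mx -mulmxA QQ mulmx1.
Qed.
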